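(* For every countable model $(M,\mathcal{X})\models\mathrm{RCA}_0+\mathrm{I}\Sigma^0_2$ there is a second-order structure $(K,\mathcal{X})$ which is a proper end extension of $(M,\mathcal{X})$ with $(M,\mathcal{X})\preccurlyeq_{\Sigma^0_2}(K,\mathcal{X})$, such that for every $\Sigma^0_1$ formula $\phi(z)$ with parameters from $(K,\mathcal{X})$ and every $a\in M$, the set $\{z<a:(K,\mathcal{X})\models\phi(z)\}$ is coded in $K$, i.e. there is $c\in K$ such that for all $z<a$, $(K,\mathcal{X})\models\phi(z)$ iff $z\in c$.
   Context: $\mathrm{RCA}_0$: Robinson arithmetic, $\Sigma^0_1$-induction, $\Delta^0_1$-comprehension; $\mathrm{I}\Sigma^0_2$ is induction for $\Sigma^0_2$ formulas. In $(K,\mathcal{X})$ the second-order universe is indexed by the same collection $\mathcal{X}$: each $A\in\mathcal{X}$ is interpreted as a subset of $K$ whose intersection with $M$ is $A$. $(M,\mathcal{X})\preccurlyeq_{\Sigma^0_2}(K,\mathcal{X})$ means every $\Sigma^0_2$ formula with parameters from $(M,\mathcal{X})$ has the same truth value in both structures; end extension means every element of $K\setminus M$ exceeds every element of $M$; proper means $K\ne M$. ''$z\in c$'' means the $z$-th binary digit of $c$ is $1$. *)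

(* Defs.v *)
(* A second-order structure whose second-order part is indexed by [S]:
   each A : S is interpreted as the subset [fun x => mem x A] of [dom]. *)
Record struct (S : Type) := Struct {
  dom : Type;
  zero : dom;
  one : dom;
  add : dom -> dom -> dom;
  mul : dom -> dom -> dom;
  lt : dom -> dom -> Prop;
  mem : dom -> S -> Prop
}.
Arguments dom {S}.
Arguments zero {S}.
Arguments one {S}.
Arguments add {S}.
Arguments mul {S}.
Arguments lt {S}.
Arguments mem {S}.

Inductive term : Type :=
| tvar : nat -> term
| tzero : term
| tone : term
| tadd : term -> term -> term
| tmul : term -> term -> term.

(* Formulas of L_2. Number variables and set variables are de Bruijn
   indices into two separate environments.  [fBAll t p] is (forall x < t, p),
   [fBEx t p] is (exists x < t, p), where t lives in the outer context. *)
Inductive form : Type :=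
| fEq : term -> term -> form
| fLt : term -> term -> form
| fMem : term -> nat -> form
| fNot : form -> form
| fAnd : form -> form -> form
| fOr : form -> form -> form
| fImp : form -> form -> form
| fAll : form -> form
| fEx : form -> form
| fBAll : term -> form -> form
| fBEx : term -> form -> form
| fAllS : form -> form
| fExS : form -> form.

Definition scons {A : Type} (a : A) (e : nat -> A) : nat -> A :=
  fun n => match n with O => a | S k => e k end.

Fixpoint evalt {S} (M : struct S) (e : nat -> dom M) (t : term) : dom M :=
  match t with
  | tvar n => e n
  | tzero => zero M
  | tone => one M
  | tadd a b => add M (evalt M e a) (evalt M e b)
  | tmul a b => mul M (evalt M e a) (evalt M e b)
  end.

Fixpoint sat {S} (M : struct S) (e : nat -> dom M) (E : nat -> S) (p : form)
  : Prop :=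
  match p with
  | fEq a b => evalt M e a = evalt M e b
  | fLt a b => lt M (evalt M e a) (evalt M e b)
  | fMem a n => mem M (evalt M e a) (E n)
  | fNot q => ~ sat M e E q
  | fAnd q r => sat M e E q /\ sat M e E r
  | fOr q r => sat M e E q \/ sat M e E r
  | fImp q r => sat M e E q -> sat M e E r
  | fAll q => forall x, sat M (scons x e) E q
  | fEx q => exists x, sat M (scons x e) E q
  | fBAll t q => forall x, lt M x (evalt M e t) -> sat M (scons x e) E q
  | fBEx t q => exists x, lt M x (evalt M e t) /\ sat M (scons x e) E q
  | fAllS q => forall A, sat M e (scons A E) q
  | fExS q => exists A, sat M e (scons A E) q
  end.

Inductive Delta0 : form -> Prop :=
| d0_eq a b : Delta0 (fEq a b)
| d0_lt a b : Delta0 (fLt a b)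
| d0_mem a n : Delta0 (fMem a n)
| d0_not p : Delta0 p -> Delta0 (fNot p)
| d0_and p q : Delta0 p -> Delta0 q -> Delta0 (fAnd p q)
| d0_or p q : Delta0 p -> Delta0 q -> Delta0 (fOr p q)
| d0_imp p q : Delta0 p -> Delta0 q -> Delta0 (fImp p q)
| d0_ball t p : Delta0 p -> Delta0 (fBAll t p)
| d0_bex t p : Delta0 p -> Delta0 (fBEx t p).

Inductive Sigma0 : nat -> form -> Prop :=
| sig_d0 n p : Delta0 p -> Sigma0 n p
| sig_pi n p : Pi0 n p -> Sigma0 (S n) p
| sig_ex n p : Sigma0 (S n) p -> Sigma0 (S n) (fEx p)
with Pi0 : nat -> form -> Prop :=
| pi_d0 n p : Delta0 p -> Pi0 n p
| pi_sig n p : Sigma0 n p -> Pi0 (S n) p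
| pi_all n p : Pi0 (S n) p -> Pi0 (S n) (fAll p).

Section Theories.
Context {S : Type} (M : struct S).
Local Notation "x + y" := (add M x y).
Local Notation "x * y" := (mul M x y).
Local Notation "x < y" := (lt M x y).

(* Basic axioms (Robinson arithmetic with <, as in Simpson's SOSOA I.2). *)
Definition basic_axioms : Prop :=
  (forall m, m + one M <> zero M) /\
  (forall m n, m + one M = n + one M -> m = n) /\
  (forall m, m + zero M = m) /\
  (forall m n, m + (n + one M) = (m + n) + one M) /\
  (forall m, m * zero M = zero M) /\
  (forall m n, m * (n + one M) = (m * n) + m) /\
  (forall m, ~ m < zero M) /\
  (forall m n, m < n + one M <-> (m < n \/ m = n)).

Definition ISigma (n : nat) : Prop :=
  forall p, Sigma0 n p -> forall e E,
    sat M (scons (zero M) e) E p ->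
    (forall x, sat M (scons x e) E p -> sat M (scons (x + one M) e) E p) ->
    forall x, sat M (scons x e) E p.

Definition Delta1CA : Prop :=
  forall p q, Sigma0 1 p -> Pi0 1 q -> forall e E,
    (forall x, sat M (scons x e) E p <-> sat M (scons x e) E q) ->
    exists A, forall x, mem M x A <-> sat M (scons x e) E p.

Definition RCA0 : Prop := basic_axioms /\ ISigma 1 /\ Delta1CA.

Definition countable_model : Prop :=
  (exists f : nat -> dom M, forall x, exists k, f k = x) /\
  (exists g : nat -> S, forall A, exists k, g k = A).

(* Coding of finite sets by binary expansion, via Goedel's beta function.
   rem b d r : r is the remainder of b divided by d. *)
Definition rem (b d r : dom M) : Prop :=
  r < d /\ exists q, b = q * d + r.
Definition beta (b c i v : dom M) : Prop :=
  rem b (one M + (i + one M) * c) v.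
Definition pow2 (z p : dom M) : Prop :=
  exists b c, beta b c (zero M) (one M) /\
    (forall i, i < z -> exists v, beta b c i v /\ beta b c (i + one M) (v + v)) /\
    beta b c z p.
Definition bit_in (z c : dom M) : Prop :=
  exists p, pow2 z p /\
    exists q r, r < p /\ c = q * (p + p) + p + r.
End Theories.

(* [i] embeds M into K, making (K,X) an extension of (M,X) (same second-order
   index set S; the trace on M of each A is the M-interpretation of A). *)
Definition extension {S} (M K : struct S) (i : dom M -> dom K) : Prop :=
  (forall x y, i x = i y -> x = y) /\
  i (zero M) = zero K /\ i (one M) = one K /\
  (forall x y, i (add M x y) = add K (i x) (i y)) /\
  (forall x y, i (mul M x y) = mul K (i x) (i y)) /\
  (forall x y, lt M x y <-> lt K (i x) (i y)) /\
  (forall x A, mem M x A <-> mem K (i x) A).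

Definition end_extension {S} (M K : struct S) (i : dom M -> dom K) : Prop :=
  extension M K i /\
  forall k, (exists x, i x = k) \/ (forall x, lt K (i x) k).

Definition proper {S} (M K : struct S) (i : dom M -> dom K) : Prop :=
  exists k, forall x, i x <> k.

Definition Sigma2_elementary {S} (M K : struct S) (i : dom M -> dom K) : Prop :=
  forall p, Sigma0 2 p -> forall (e : nat -> dom M) (E : nat -> S),
    sat M e E p <-> sat K (fun n => i (e n)) E p.

(* Main.v *)
(* K is an ultrapower of M.  Its elements are given by the functions with a
   Sigma_1 graph (parameters allowed) on one of the sets of a decreasing
   sequence D_0, D_1, ... of unbounded Sigma_1 subsets of M, and two of them are
   identified when they agree on some D_k.  The sequence is generic: for every
   Sigma_1 family (W_z) and every a in M there are k and s in M such that, for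
   all z < a, D_k is contained in W_z if z is in s and disjoint from W_z if not.
   I Sigma_2 provides such an s as the largest binary code below 2^a for which
   the current D_k meets the intersection of the W_z with z in s in an unbounded
   set.  Genericity gives Los's theorem for Sigma_1 formulas, whence
   Sigma_2-elementarity; applied to W_z = {n : h(n) = z} it shows that K is an
   end extension, and applied to the sets of indices at which phi(z) holds it
   gives the codes, which even lie in M. *)

From Stdlib Require Import Classical ClassicalEpsilon FunctionalExtensionality.
From Stdlib Require Import PropExtensionality ProofIrrelevance.
From Stdlib Require Import Arith Lia Cantor Ring.
Require Import Defs.

(** * Countability of the set of formulas *)

(** The number a of sets W_z to be decided may be nonstandard, so they cannot be treated one after
    another outside M; and unboundedness of a Sigma_1 set is a Pi_2 condition, so the search for s
    costs exactly one Sigma_2-induction. The sequence itself is built outside M: with all parameters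
    listed by two fixed environments, a requirement is a formula together with a bound, and there
    are countably many of them. Functions with Sigma_1 graph are taken because they are closed under
    choosing a witness of a Sigma_1 formula, which is what the existential case of Los's theorem
    asks for. They are partial because the witness may exist only at the indices in some D_k. Los's
    theorem for Sigma_2 formulas is therefore proved only from K to the indices; for the other half
    of elementarity a witness in M is embedded as a constant function. *)

Definition npair (a b : nat) : nat := to_nat (a, b).

Lemma npair_inj a b c d : npair a b = npair c d -> a = c /\ b = d.
Proof.
  unfold npair; intros H; apply to_nat_inj in H; injection H; auto.
Qed.

Fixpoint term_code (t : term) : nat :=
  match t with
  | tvar n => npair 0 n
  | tzero => npair 1 0
  | tone => npair 2 0
  | tadd a b => npair 3 (npair (term_code a) (term_code b))
  | tmul a b => npair 4 (npair (term_code a) (term_code b))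
  end.

Fixpoint form_code (p : form) : nat :=
  match p with
  | fEq a b => npair 0 (npair (term_code a) (term_code b))
  | fLt a b => npair 1 (npair (term_code a) (term_code b))
  | fMem a n => npair 2 (npair (term_code a) n)
  | fNot q => npair 3 (form_code q)
  | fAnd q r => npair 4 (npair (form_code q) (form_code r))
  | fOr q r => npair 5 (npair (form_code q) (form_code r))
  | fImp q r => npair 6 (npair (form_code q) (form_code r))
  | fAll q => npair 7 (form_code q)
  | fEx q => npair 8 (form_code q)
  | fBAll t q => npair 9 (npair (term_code t) (form_code q))
  | fBEx t q => npair 10 (npair (term_code t) (form_code q))
  | fAllS q => npair 11 (form_code q)
  | fExS q => npair 12 (form_code q)
  end.

Ltac code_inj :=
  repeat match goal with
  | H : npair _ _ = npair _ _ |- _ =>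
      apply npair_inj in H; destruct H; try discriminate
  end; subst; f_equal; auto.

Lemma term_code_inj (s t : term) : term_code s = term_code t -> s = t.
Proof.
  revert t; induction s; intros [] H; cbn [term_code] in H; code_inj.
Qed.

Lemma form_code_inj (p q : form) : form_code p = form_code q -> p = q.
Proof.
  revert q; induction p; intros [] H; cbn [form_code] in H; code_inj;
    auto using term_code_inj.
Qed.

Lemma form_enum : exists dec : nat -> form, forall p, exists c, dec c = p.
Proof.
  exists (fun c => epsilon (inhabits (fEq tzero tzero))
                     (fun p => form_code p = c)).
  intros p; exists (form_code p); apply form_code_inj.
  apply epsilon_spec; eauto.
Qed.

(** * Substitution *)

Fixpoint tsubst (s : nat -> term) (t : term) : term :=
  match t with
  | tvar n => s n
  | tzero => tzero
  | tone => tone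
  | tadd a b => tadd (tsubst s a) (tsubst s b)
  | tmul a b => tmul (tsubst s a) (tsubst s b)
  end.

Definition tlift : term -> term := tsubst (fun n => tvar (S n)).

Definition up (s : nat -> term) : nat -> term :=
  scons (tvar 0) (fun n => tlift (s n)).

Definition ups (r : nat -> nat) : nat -> nat := scons 0 (fun n => S (r n)).

Fixpoint fsubst (s : nat -> term) (r : nat -> nat) (p : form) : form :=
  match p with
  | fEq a b => fEq (tsubst s a) (tsubst s b)
  | fLt a b => fLt (tsubst s a) (tsubst s b)
  | fMem a n => fMem (tsubst s a) (r n)
  | fNot q => fNot (fsubst s r q)
  | fAnd q q' => fAnd (fsubst s r q) (fsubst s r q')
  | fOr q q' => fOr (fsubst s r q) (fsubst s r q')
  | fImp q q' => fImp (fsubst s r q) (fsubst s r q')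
  | fAll q => fAll (fsubst (up s) r q)
  | fEx q => fEx (fsubst (up s) r q)
  | fBAll t q => fBAll (tsubst s t) (fsubst (up s) r q)
  | fBEx t q => fBEx (tsubst s t) (fsubst (up s) r q)
  | fAllS q => fAllS (fsubst s (ups r) q)
  | fExS q => fExS (fsubst s (ups r) q)
  end.

Lemma Delta0_fsubst (p : form) (s : nat -> term) (r : nat -> nat) :
  Delta0 p -> Delta0 (fsubst s r p).
Proof.
  intros H; revert s; induction H; intros s; simpl; constructor; auto.
Qed.

Section Substitution.
Context {X : Type} (M : struct X).

Lemma evalt_tsubst (e : nat -> dom M) (s : nat -> term) (t : term) :
  evalt M e (tsubst s t) = evalt M (fun n => evalt M e (s n)) t.
Proof.
  induction t; simpl; congruence.
Qed.

Lemma evalt_tlift (x : dom M) (e : nat -> dom M) (t : term) :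
  evalt M (scons x e) (tlift t) = evalt M e t.
Proof.
  unfold tlift; rewrite evalt_tsubst; reflexivity.
Qed.

Lemma evalt_up (x : dom M) (e : nat -> dom M) (s : nat -> term) :
  (fun n => evalt M (scons x e) (up s n)) =
  scons x (fun n => evalt M e (s n)).
Proof.
  apply functional_extensionality; intros [|n]; [reflexivity|].
  apply evalt_tlift.
Qed.

Lemma sat_fsubst (p : form) :
  forall (e : nat -> dom M) (E : nat -> X) (s : nat -> term) (r : nat -> nat),
  sat M e E (fsubst s r p) <->
  sat M (fun n => evalt M e (s n)) (fun n => E (r n)) p.
Proof.
  assert (HE : forall A E r, (fun n => @scons X A E (ups r n)) =
                             scons A (fun n => E (r n))).
  { intros; apply functional_extensionality; intros [|n]; reflexivity. }
  induction p; intros e E s r; simpl; rewrite ?evalt_tsubst;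
    try reflexivity;
    repeat match goal with IH : forall _ _ _ _, _ <-> _ |- _ =>
      setoid_rewrite IH; clear IH end;
    try setoid_rewrite evalt_up; try setoid_rewrite HE; reflexivity.
Qed.

End Substitution.

(** * A formula for binary digits *)

Definition fbeta (b c i v : term) : form :=
  let d := tadd tone (tmul (tadd i tone) c) in
  fAnd (fLt v d) (fBEx (tadd b tone)
    (fEq (tlift b) (tadd (tmul (tvar 0) (tlift d)) (tlift v)))).

(* Under the five existential quantifiers, the variables 0 to 6 stand for
   r, q, c, b, p, z and the coded set.  The quantifiers on values and on
   quotients, unbounded in beta, are bounded by b. *)
Definition fbit : form :=
  fEx (fEx (fEx (fEx (fEx
    (fAnd (fAnd (fLt (tvar 0) (tvar 4))
                (fEq (tvar 6) (tadd (tadd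
                  (tmul (tvar 1) (tadd (tvar 4) (tvar 4))) (tvar 4)) (tvar 0))))
    (fAnd (fbeta (tvar 3) (tvar 2) tzero tone)
    (fAnd (fBAll (tvar 5) (fBEx (tadd (tvar 4) tone)
            (fAnd (fbeta (tvar 5) (tvar 4) (tvar 1) (tvar 0))
                  (fbeta (tvar 5) (tvar 4) (tadd (tvar 1) tone)
                         (tadd (tvar 0) (tvar 0))))))
          (fbeta (tvar 3) (tvar 2) (tvar 5) (tvar 4))))))))).

Lemma Sigma2_fbit : Sigma0 2 fbit.
Proof. repeat apply sig_ex; apply sig_d0; repeat constructor. Qed.

(** This is what makes bounding quotients and remainders by the dividend harmless. It is isolated as
    a hypothesis because [sat_fbit] is applied both in the model and in its ultrapower. *)
Definition division_bounds {X} (M : struct X) : Prop :=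
  forall q d v b, b = add M (mul M q (add M (one M) d)) v ->
    lt M q (add M b (one M)) /\ lt M v (add M b (one M)).

Section Digits.
Context {X : Type} (M : struct X) (HM : division_bounds M).

Lemma sat_fbeta e E b c i v :
  sat M e E (fbeta b c i v) <->
  beta M (evalt M e b) (evalt M e c) (evalt M e i) (evalt M e v).
Proof.
  unfold fbeta, beta, rem; simpl; setoid_rewrite evalt_tlift; simpl.
  split; intros [Hv [q Hq]]; split; auto; exists q; [apply Hq |].
  split; auto; apply (HM _ _ _ _ Hq).
Qed.

Lemma sat_fbit e E z s :
  sat M (scons z (scons s e)) E fbit <-> bit_in M z s.
Proof.
  unfold fbit, bit_in, pow2; cbn [sat]; setoid_rewrite sat_fbeta; simpl.
  split.
  - intros [p [b [c [q [r [[Hr Hs] [H0 [HS Hp]]]]]]]].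
    exists p; split; [exists b, c; split; [auto | split; auto] | eauto].
    intros i Hi; destruct (HS i Hi) as [v [_ Hv]]; eauto.
  - intros [p [[b [c [H0 [HS Hp]]]] [q [r [Hr Hs]]]]].
    exists p, b, c, q, r; split; [auto | split; [auto | split; auto]].
    intros i Hi; destruct (HS i Hi) as [v [Hv Hv2]]; exists v; split; auto.
    destruct Hv as [_ [q' Hq']]; apply (HM _ _ _ _ Hq').
Qed.

End Digits.

(** * Finite support *)

Lemma evalt_support {X} (M : struct X) (t : term) :
  exists N, forall e e' : nat -> dom M, (forall j, j < N -> e j = e' j) ->
    evalt M e t = evalt M e' t.
Proof.
  induction t as [n | | | s [N HN] t [N' HN'] | s [N HN] t [N' HN']]; simpl.
  - exists (S n); auto.
  - exists 0; auto.
  - exists 0; auto.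
  - exists (N + N'); intros e e' H; rewrite (HN e e'), (HN' e e'); auto;
      intros; apply H; lia.
  - exists (N + N'); intros e e' H; rewrite (HN e e'), (HN' e e'); auto;
      intros; apply H; lia.
Qed.

Lemma scons_agree {A : Type} (N : nat) (x : A) (e e' : nat -> A) :
  (forall j, j < N -> e j = e' j) ->
  forall j, j < N -> scons x e j = scons x e' j.
Proof. intros H [|j] Hj; simpl; auto; apply H; lia. Qed.

(** Reduces statements about environments in the ultrapower to finitely many functions, which do
    have a common D_k. *)
Lemma sat_support {X} (M : struct X) (p : form) :
  exists N, forall E (e e' : nat -> dom M), (forall j, j < N -> e j = e' j) ->
    (sat M e E p <-> sat M e' E p).
Proof.
  induction p as [a b | a b | a n | q [N HN] | q [N HN] r [N' HN']
    | q [N HN] r [N' HN'] | q [N HN] r [N' HN'] | q [N HN] | q [N HN]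
    | t q [N HN] | t q [N HN] | q [N HN] | q [N HN]]; simpl.
  - destruct (evalt_support M a) as [N HN], (evalt_support M b) as [N' HN'].
    exists (N + N'); intros E e e' H; rewrite (HN e e'), (HN' e e');
      [tauto | |]; intros; apply H; lia.
  - destruct (evalt_support M a) as [N HN], (evalt_support M b) as [N' HN'].
    exists (N + N'); intros E e e' H; rewrite (HN e e'), (HN' e e');
      [tauto | |]; intros; apply H; lia.
  - destruct (evalt_support M a) as [N HN].
    exists N; intros E e e' H; rewrite (HN e e'); [tauto | auto].
  - exists N; intros E e e' H; rewrite (HN E e e'); [tauto | auto].
  - exists (N + N'); intros E e e' H; rewrite (HN E e e'), (HN' E e e');
      [tauto | |]; intros; apply H; lia.
  - exists (N + N'); intros E e e' H; rewrite (HN E e e'), (HN' E e e');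
      [tauto | |]; intros; apply H; lia.
  - exists (N + N'); intros E e e' H; rewrite (HN E e e'), (HN' E e e');
      [tauto | |]; intros; apply H; lia.
  - exists N; intros E e e' H; split; intros Hq x;
      apply (HN E _ _ (scons_agree N x e e' H)), Hq.
  - exists N; intros E e e' H; split; intros [x Hx]; exists x;
      apply (HN E _ _ (scons_agree N x e e' H)), Hx.
  - destruct (evalt_support M t) as [N' HN'].
    exists (N + N'); intros E e e' H.
    rewrite (HN' e e') by (intros; apply H; lia).
    assert (H' : forall j, j < N -> e j = e' j) by (intros; apply H; lia).
    split; intros Hq x Hx;
      apply (HN E _ _ (scons_agree N x e e' H')), Hq, Hx.
  - destruct (evalt_support M t) as [N' HN'].
    exists (N + N'); intros E e e' H.
    rewrite (HN' e e') by (intros; apply H; lia).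
    assert (H' : forall j, j < N -> e j = e' j) by (intros; apply H; lia).
    split; intros [x [Hx Hq]]; exists x; split; auto;
      apply (HN E _ _ (scons_agree N x e e' H')), Hq.
  - exists N; intros E e e' H; split; intros Hq A; apply (HN _ e e' H), Hq.
  - exists N; intros E e e' H; split; intros [A HA]; exists A;
      apply (HN _ e e' H), HA.
Qed.

(** * Definability with parameters *)

Section Model.
Context {X : Type} (M : struct X).
Context (f : nat -> dom M) (fsurj : forall x, exists k, f k = x).
Context (g : nat -> X) (gsurj : forall A, exists k, g k = A).

Declare Scope model_scope.
Delimit Scope model_scope with M.
Local Notation "0" := (zero M) : model_scope.
Local Notation "1" := (one M) : model_scope.
Local Notation "x + y" := (add M x y) : model_scope.
Local Notation "x * y" := (mul M x y) : model_scope.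
Local Notation "x < y" := (lt M x y) : model_scope.
Local Open Scope model_scope.
Bind Scope model_scope with dom.

(* All elements and all sets are available as parameters through the fixed
   environments f and g; the first d entries of an environment are free. *)
Definition over (d : nat) (e : nat -> dom M) : Prop :=
  forall n, e (d + n)%nat = f n.

Definition DT (d : nat) (t : (nat -> dom M) -> dom M) : Prop :=
  exists u, forall e, over d e -> evalt M e u = t e.

(** Definability is a property of Rocq predicates on environments, so that proofs manipulate
    ordinary predicates and the tactics [d0] and [s1] recover the formulas. *)
Definition D0 (d : nat) (P : (nat -> dom M) -> Prop) : Prop :=
  exists p, Delta0 p /\ forall e, over d e -> (sat M e g p <-> P e).

(** A normal form with a single unbounded quantifier; the closure properties below contract further
    quantifiers into it. *)
Definition S1 (d : nat) (P : (nat -> dom M) -> Prop) : Prop :=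
  exists p, Delta0 p /\
    forall e, over d e -> ((exists w, sat M (scons w e) g p) <-> P e).

Lemma over_scons (d : nat) (x : dom M) (e : nat -> dom M) :
  over d e -> over (S d) (scons x e).
Proof. intros H n; apply H. Qed.

Lemma DT_var (d n : nat) : DT d (fun e => e n).
Proof. exists (tvar n); reflexivity. Qed.

Lemma DT_cst (d : nat) (a : dom M) : DT d (fun _ => a).
Proof.
  destruct (fsurj a) as [k Hk]; exists (tvar (d + k)); intros e He.
  rewrite <- Hk; apply He.
Qed.

Lemma DT_add (d : nat) s t :
  DT d s -> DT d t -> DT d (fun e => s e + t e).
Proof.
  intros [u Hu] [v Hv]; exists (tadd u v); intros e He; simpl.
  rewrite Hu, Hv; auto.
Qed.

Lemma DT_mul (d : nat) s t :
  DT d s -> DT d t -> DT d (fun e => s e * t e).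
Proof.
  intros [u Hu] [v Hv]; exists (tmul u v); intros e He; simpl.
  rewrite Hu, Hv; auto.
Qed.

Lemma DT_weaken d t : DT d t -> DT (S d) (fun e => t (fun n => e (S n))).
Proof.
  intros [u Hu]; exists (tlift u); intros e He.
  replace e with (scons (e O) (fun n => e (S n))) at 1
    by (apply functional_extensionality; intros [|]; reflexivity).
  rewrite evalt_tlift; apply Hu, He.
Qed.

Lemma D0_eq (d : nat) s t : DT d s -> DT d t -> D0 d (fun e => s e = t e).
Proof.
  intros [u Hu] [v Hv]; exists (fEq u v); split; [constructor|].
  intros e He; simpl; rewrite Hu, Hv; tauto.
Qed.

Lemma D0_lt (d : nat) s t : DT d s -> DT d t -> D0 d (fun e => s e < t e).
Proof.
  intros [u Hu] [v Hv]; exists (fLt u v); split; [constructor|].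
  intros e He; simpl; rewrite Hu, Hv; tauto.
Qed.

Lemma D0_not (d : nat) P : D0 d P -> D0 d (fun e => ~ P e).
Proof.
  intros [p [Dp Hp]]; exists (fNot p); split; [constructor; auto|].
  intros e He; simpl; rewrite Hp; tauto.
Qed.

Lemma D0_and (d : nat) P Q : D0 d P -> D0 d Q -> D0 d (fun e => P e /\ Q e).
Proof.
  intros [p [Dp Hp]] [q [Dq Hq]]; exists (fAnd p q).
  split; [constructor; auto|].
  intros e He; simpl; rewrite Hp, Hq; tauto.
Qed.

Lemma D0_or (d : nat) P Q : D0 d P -> D0 d Q -> D0 d (fun e => P e \/ Q e).
Proof.
  intros [p [Dp Hp]] [q [Dq Hq]]; exists (fOr p q).
  split; [constructor; auto|].
  intros e He; simpl; rewrite Hp, Hq; tauto.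
Qed.

Lemma D0_imp (d : nat) P Q :
  D0 d P -> D0 d Q -> D0 d (fun e => P e -> Q e).
Proof.
  intros [p [Dp Hp]] [q [Dq Hq]]; exists (fImp p q).
  split; [constructor; auto|].
  intros e He; simpl; rewrite Hp, Hq; tauto.
Qed.

Lemma D0_ball (d : nat) t P :
  DT d t -> D0 (S d) (fun e => P (fun n => e (S n)) (e O)) ->
  D0 d (fun e => forall x, x < t e -> P e x).
Proof.
  intros [u Hu] [p [Dp Hp]]; exists (fBAll u p).
  split; [constructor; auto|].
  intros e He; simpl; rewrite Hu by auto.
  split; intros H x Hx; apply (Hp _ (over_scons d x e He)); apply H; auto.
Qed.

Lemma D0_bex (d : nat) t P :
  DT d t -> D0 (S d) (fun e => P (fun n => e (S n)) (e O)) ->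
  D0 d (fun e => exists x, x < t e /\ P e x).
Proof.
  intros [u Hu] [p [Dp Hp]]; exists (fBEx u p).
  split; [constructor; auto|].
  intros e He; simpl; rewrite Hu by auto.
  split; intros [x [Hx H]]; exists x; split; auto;
    apply (Hp _ (over_scons d x e He)); auto.
Qed.

Lemma terms_choice (d : nat) (t : (nat -> dom M) -> nat -> dom M) :
  (forall j, DT d (fun e => t e j)) ->
  exists s : nat -> term, forall e, over d e ->
    (fun j => evalt M e (s j)) = t e.
Proof.
  intros H.
  exists (fun j => proj1_sig (constructive_indefinite_description _ (H j))).
  intros e He; apply functional_extensionality; intros j.
  destruct (constructive_indefinite_description _ (H j)) as [u Hu]; simpl.
  auto.
Qed.

Lemma sets_choice (E : nat -> X) : exists r, (fun n => g (r n)) = E.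
Proof.
  exists (fun n =>
    proj1_sig (constructive_indefinite_description _ (gsurj (E n)))).
  apply functional_extensionality; intros j.
  now destruct (constructive_indefinite_description _ (gsurj (E j))).
Qed.

(** Any set environment is a reindexing of [g], since [g] is surjective; so renaming set variables
    and substituting terms brings p back to the fixed environments. *)
Lemma D0_sat (d : nat) (p : form) t (E : nat -> X) :
  Delta0 p -> (forall j, DT d (fun e => t e j)) ->
  D0 d (fun e => sat M (t e) E p).
Proof.
  intros Dp H; destruct (terms_choice d t H) as [s Hs].
  destruct (sets_choice E) as [r Hr].
  exists (fsubst s r p); split; [now apply Delta0_fsubst|].
  intros e He; rewrite sat_fsubst, Hs, Hr by auto; tauto.
Qed.

Lemma DT_scons (d : nat) (x : (nat -> dom M) -> dom M)
    (t : (nat -> dom M) -> nat -> dom M) :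
  DT d x -> (forall j, DT d (fun e => t e j)) ->
  forall j, DT d (fun e => scons (x e) (t e) j).
Proof. intros Hx Ht [|j]; simpl; auto. Qed.

Lemma DT_env (d : nat) (c : nat -> dom M) : forall j, DT d (fun _ => c j).
Proof. intros j; apply DT_cst. Qed.

Lemma over_1 (x : dom M) : over 1 (scons x f).
Proof. intros n; reflexivity. Qed.

Lemma over_2 (x y : dom M) : over 2 (scons x (scons y f)).
Proof. intros n; reflexivity. Qed.

Lemma over_3 (x y z : dom M) : over 3 (scons x (scons y (scons z f))).
Proof. intros n; reflexivity. Qed.

Lemma D0_equiv (d : nat) P Q :
  (forall e, over d e -> (P e <-> Q e)) -> D0 d P -> D0 d Q.
Proof.
  intros H [p [Dp Hp]]; exists p; split; auto.
  intros e He; rewrite Hp; auto.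
Qed.

Lemma S1_equiv (d : nat) P Q :
  (forall e, over d e -> (P e <-> Q e)) -> S1 d P -> S1 d Q.
Proof.
  intros H [p [Dp Hp]]; exists p; split; auto.
  intros e He; rewrite Hp; auto.
Qed.

Lemma D0_app1 (d : nat) (P : dom M -> Prop) a :
  D0 1 (fun e => P (e O)) -> DT d a -> D0 d (fun e => P (a e)).
Proof.
  intros [p [Dp Hp]] Ha.
  apply (D0_equiv d (fun e => sat M (scons (a e) f) g p)).
  - intros e _; rewrite Hp by apply over_1; reflexivity.
  - apply D0_sat; auto using DT_scons, DT_env.
Qed.

Lemma D0_app2 (d : nat) (P : dom M -> dom M -> Prop) a b :
  D0 2 (fun e => P (e O) (e 1%nat)) -> DT d a -> DT d b ->
  D0 d (fun e => P (a e) (b e)).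
Proof.
  intros [p [Dp Hp]] Ha Hb.
  apply (D0_equiv d (fun e => sat M (scons (a e) (scons (b e) f)) g p)).
  - intros e _; rewrite Hp by apply over_2; reflexivity.
  - apply D0_sat; auto using DT_scons, DT_env.
Qed.

Lemma S1_D0 (d : nat) P : D0 d P -> S1 d P.
Proof.
  intros [p [Dp Hp]].
  exists (fsubst (fun n => tvar (S n)) (fun n => n) p).
  split; [now apply Delta0_fsubst|].
  intros e He; rewrite <- Hp by auto; setoid_rewrite sat_fsubst; simpl.
  split; [intros [_ H]; exact H | intros H; exists (zero M); exact H].
Qed.

Ltac dt :=
  cbv beta;
  first [ apply DT_add; dt | apply DT_mul; dt | apply DT_var | apply DT_cst ].

Ltac env := repeat apply DT_scons; intros; dt.

Ltac d0 :=
  cbv beta;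
  first
  [ assumption
  | apply D0_sat; [assumption | env]
  | apply D0_eq; dt | apply D0_lt; dt
  | apply D0_and; d0 | apply D0_or; d0 | apply D0_not; d0
  | apply D0_ball; [dt | d0] | apply D0_bex; [dt | d0]
  | apply D0_imp; d0
  | match goal with H : D0 2 (fun e => ?P (e O) (e 1%nat)) |- _ =>
      apply (D0_app2 _ P); [exact H | dt | dt] end
  | match goal with H : D0 1 (fun e => ?P (e O)) |- _ =>
      apply (D0_app1 _ P); [exact H | dt] end ].

(** * Ordered semiring structure *)

Context (BA : basic_axioms M) (IS1 : ISigma M 1).

Lemma ind0 (P : dom M -> Prop) :
  D0 1 (fun e => P (e O)) -> P 0 -> (forall x, P x -> P (x + 1)) ->
  forall x, P x.
Proof.
  intros [p [Dp Hp]] H0 HS x.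
  apply (Hp (scons x f) (over_1 x)).
  apply IS1; [now constructor | |].
  - apply (Hp (scons 0 f) (over_1 _)); exact H0.
  - intros y Hy; apply (Hp (scons (y + 1) f) (over_1 _)).
    apply HS, (Hp (scons y f) (over_1 y)), Hy.
Qed.

Lemma ind_ex (P : dom M -> dom M -> Prop) :
  D0 2 (fun e => P (e O) (e 1%nat)) -> (exists w, P w 0) ->
  (forall x, (exists w, P w x) -> exists w, P w (x + 1)) ->
  forall x, exists w, P w x.
Proof.
  intros [p [Dp Hp]] H0 HS x.
  assert (HP : forall y, sat M (scons y f) g (fEx p) <-> exists w, P w y).
  { intros y; split; intros [w Hw]; exists w;
      apply (Hp (scons w (scons y f)) (over_2 w y)), Hw. }
  apply HP, IS1.
  - apply sig_ex, sig_d0, Dp.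
  - apply HP, H0.
  - intros y Hy; apply HP, HS, HP, Hy.
Qed.

Lemma succ_ne0 x : x + 1 <> 0.
Proof. apply BA. Qed.
Lemma succ_inj x y : x + 1 = y + 1 -> x = y.
Proof. apply BA. Qed.
Lemma add0r x : x + 0 = x.
Proof. apply BA. Qed.
Lemma addS x y : x + (y + 1) = (x + y) + 1.
Proof. apply BA. Qed.
Lemma mul0r x : x * 0 = 0.
Proof. apply BA. Qed.
Lemma mulS x y : x * (y + 1) = x * y + x.
Proof. apply BA. Qed.
Lemma lt_0 x : ~ x < 0.
Proof. apply BA. Qed.
Lemma lt_S x y : x < y + 1 <-> x < y \/ x = y.
Proof. apply BA. Qed.

Lemma add0l x : 0 + x = x.
Proof.
  apply (ind0 (fun x => 0 + x = x)); [d0 | apply add0r |].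
  intros y H; rewrite addS, H; reflexivity.
Qed.

Lemma addSl x y : (x + 1) + y = (x + y) + 1.
Proof.
  apply (ind0 (fun y => (x + 1) + y = (x + y) + 1)); [d0 | |].
  - rewrite !add0r; reflexivity.
  - intros z H; rewrite !addS, H; reflexivity.
Qed.

Lemma addC x y : x + y = y + x.
Proof.
  apply (ind0 (fun y => x + y = y + x)); [d0 | |].
  - rewrite add0r, add0l; reflexivity.
  - intros z H; rewrite addS, addSl, H; reflexivity.
Qed.

Lemma addA x y z : x + (y + z) = (x + y) + z.
Proof.
  apply (ind0 (fun z => x + (y + z) = (x + y) + z)); [d0 | |].
  - rewrite !add0r; reflexivity.
  - intros w H; rewrite !addS, H; reflexivity.
Qed.

Lemma mul0l x : 0 * x = 0.
Proof.
  apply (ind0 (fun x => 0 * x = 0)); [d0 | apply mul0r |].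
  intros y H; rewrite mulS, H; apply add0r.
Qed.

Lemma mulSl x y : (x + 1) * y = x * y + y.
Proof.
  apply (ind0 (fun y => (x + 1) * y = x * y + y)); [d0 | |].
  - rewrite !mul0r, add0r; reflexivity.
  - intros z H; rewrite !mulS, H, !addS; f_equal.
    rewrite <- !addA, (addC z x); reflexivity.
Qed.

Lemma mulC x y : x * y = y * x.
Proof.
  apply (ind0 (fun y => x * y = y * x)); [d0 | |].
  - rewrite mul0r, mul0l; reflexivity.
  - intros z H; rewrite mulS, mulSl, H; reflexivity.
Qed.

Lemma mulDl x y z : (x + y) * z = x * z + y * z.
Proof.
  apply (ind0 (fun z => (x + y) * z = x * z + y * z)); [d0 | |].
  - rewrite !mul0r, add0r; reflexivity.
  - intros w H; rewrite !mulS, H, <- !addA; f_equal.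
    rewrite !addA, (addC (y * w) x); reflexivity.
Qed.

Lemma mulA x y z : x * (y * z) = (x * y) * z.
Proof.
  apply (ind0 (fun z => x * (y * z) = (x * y) * z)); [d0 | |].
  - rewrite !mul0r; reflexivity.
  - intros w H.
    rewrite !mulS, <- H, (mulC x (y * w + y)), mulDl, (mulC _ x), (mulC _ x).
    reflexivity.
Qed.

Lemma mul1l x : 1 * x = x.
Proof. rewrite <- (add0l 1), mulSl, mul0l; apply add0l. Qed.

Lemma model_semiring : semi_ring_theory 0 1 (add M) (mul M) eq.
Proof.
  constructor; auto using add0l, addC, addA, mul1l, mul0l, mulC, mulA, mulDl.
Qed.

Add Ring model_ring : model_semiring.

Lemma addI x y z : x + z = y + z -> x = y.
Proof.
  apply (ind0 (fun z => x + z = y + z -> x = y)); [d0 | |].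
  - rewrite !add0r; auto.
  - intros w H; rewrite !addS; intros E; apply H, succ_inj, E.
Qed.

Lemma no_fix x d : x <> x + d + 1.
Proof.
  intros H; apply (succ_ne0 d), (addI _ _ x).
  replace (d + 1 + x) with (x + d + 1) by ring; rewrite <- H; ring.
Qed.

Lemma zero_or_succ x : x = 0 \/ exists y, x = y + 1.
Proof.
  assert (H : exists y, x = 0 \/ x = y + 1).
  { apply (ind_ex (fun y x => x = 0 \/ x = y + 1)); [d0 | |].
    - exists 0; auto.
    - intros y _; exists y; auto. }
  destruct H as [y [H | H]]; eauto.
Qed.

Lemma lt_ex x y : x < y <-> exists d, y = x + d + 1.
Proof.
  split.
  - intros H.
    (* With the hypothesis x < y inside the matrix, the induction formula is a single existential
       quantifier over a Delta_0 formula. *)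
    assert (H' : exists d, x < y -> y = x + d + 1).
    { clear H; apply (ind_ex (fun d y => x < y -> y = x + d + 1)); [d0 | |].
      - exists 0; intros H; destruct (lt_0 _ H).
      - intros z [d Hd].
        destruct (classic (x < z)) as [Hz | Hz].
        + exists (d + 1); intros _; rewrite (Hd Hz) at 1; ring.
        + exists 0; intros H; apply lt_S in H; destruct H as [H | ->];
            [tauto | ring]. }
    destruct H' as [d Hd]; eauto.
  - intros [d ->].
    apply (ind0 (fun d => x < x + d + 1)); [d0 | |].
    + apply lt_S; right; ring.
    + intros z H; apply lt_S; left; rewrite addA; exact H.
Qed.

(** The language has no weak inequality; [x < y + 1] stands for it throughout. *)
Lemma le_ex x y : x < y + 1 <-> exists d, y = x + d.
Proof.
  rewrite lt_ex; split; intros [d H]; exists d; [| rewrite H; ring].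
  now apply succ_inj.
Qed.

Lemma lt_irrefl x : ~ x < x.
Proof.
  intros H; apply lt_ex in H; destruct H as [d H]; now apply no_fix in H.
Qed.

Lemma lt_trans x y z : x < y -> y < z -> x < z.
Proof.
  rewrite !lt_ex; intros [d ->] [d' ->]; exists (d + d' + 1); ring.
Qed.

Lemma lt_total x y : x < y \/ x = y \/ y < x.
Proof.
  apply (ind0 (fun y => x < y \/ x = y \/ y < x)); [d0 | |].
  - destruct (zero_or_succ x) as [-> | [z ->]]; auto.
    right; right; apply lt_ex; exists z; ring.
  - intros z [H | [-> | H]].
    + left; apply lt_S; auto.
    + left; apply lt_S; auto.
    + apply lt_ex in H; destruct H as [d ->].
      destruct (zero_or_succ d) as [-> | [w ->]].
      * right; left; ring.
      * right; right; apply lt_ex; exists w; ring.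
Qed.

Lemma lt_asym x y : x < y -> y < x + 1 -> False.
Proof.
  intros H1 H2; apply lt_S in H2; destruct H2 as [H2 | ->].
  - now apply (lt_irrefl x), lt_trans with y.
  - now apply (lt_irrefl x).
Qed.

Lemma lt_or_le x y : x < y \/ y < x + 1.
Proof. destruct (lt_total x y) as [H | [H | H]]; rewrite ?lt_S; auto. Qed.

Lemma lt_succ x : x < x + 1.
Proof. apply lt_S; auto. Qed.

Lemma lt_le_trans x y z : x < y -> y < z + 1 -> x < z.
Proof.
  intros H1 H2; apply lt_S in H2; destruct H2 as [H2 | <-]; auto.
  now apply lt_trans with y.
Qed.

Lemma lt_add x y : x < x + y + 1.
Proof. apply lt_ex; eauto. Qed.

Lemma lt_addl x y : x < y + x + 1.
Proof. apply lt_ex; exists y; ring. Qed.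

(** * Sigma_1 definability *)

(** Collection follows from Sigma_1-induction on the length y of the initial segment whose witnesses
    have a common bound. The clause x < a makes the step trivial once y has reached a. *)
Lemma collect0 (P : dom M -> dom M -> Prop) (a : dom M) :
  D0 2 (fun e => P (e O) (e 1%nat)) ->
  (forall x, x < a -> exists w, P w x) ->
  exists u, forall x, x < a -> exists w, w < u /\ P w x.
Proof.
  intros DP H.
  assert (Hy : forall y, exists u, forall x, x < y -> x < a ->
            exists w, w < u /\ P w x).
  { apply (ind_ex (fun u y => forall x, x < y -> x < a ->
            exists w, w < u /\ P w x)); [d0 | |].
    - exists 0; intros x Hx; destruct (lt_0 _ Hx).
    - intros y [u Hu].
      destruct (classic (y < a)) as [Ha | Ha].
      + destruct (H y Ha) as [w Hw]; exists (u + w + 1); intros x Hx Hxa.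
        apply lt_S in Hx; destruct Hx as [Hx | ->].
        * destruct (Hu x Hx Hxa) as [w' [Hw' HP]]; exists w'; split; auto.
          apply lt_trans with u; auto; apply lt_add.
        * exists w; split; auto; apply lt_addl.
      + exists u; intros x Hx Hxa; apply lt_S in Hx; destruct Hx as [Hx | ->];
          [auto | tauto]. }
  destruct (Hy a) as [u Hu]; exists u; auto.
Qed.

Lemma S1_ex_D0 (d : nat) P :
  D0 (S d) (fun e => P (fun n => e (S n)) (e O)) ->
  S1 d (fun e => exists w, P e w).
Proof.
  intros [p [Dp Hp]]; exists p; split; auto.
  intros e He; split; intros [w Hw]; exists w;
    apply (Hp (scons w e) (over_scons d w e He)), Hw.
Qed.

(** Two existential quantifiers are contracted without pairing: one number u bounds both
    witnesses. *)
Lemma S1_ex (d : nat) P :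
  S1 (S d) (fun e => P (fun n => e (S n)) (e O)) ->
  S1 d (fun e => exists x, P e x).
Proof.
  intros [p [Dp Hp]].
  apply (S1_equiv d (fun e => exists u, exists x, x < u /\
           exists w, w < u /\ sat M (scons w (scons x e)) g p)).
  - intros e He; split.
    + intros [u [x [_ [w [_ H]]]]]; exists x.
      apply (Hp (scons x e) (over_scons d x e He)); eauto.
    + intros [x H]; apply (Hp (scons x e) (over_scons d x e He)) in H.
      destruct H as [w Hw].
      exists (x + w + 1), x; split; [apply lt_add | exists w].
      split; [apply lt_addl | auto].
  - apply S1_ex_D0; d0.
Qed.

Lemma S1_or (d : nat) P Q : S1 d P -> S1 d Q -> S1 d (fun e => P e \/ Q e).
Proof.
  intros [p [Dp Hp]] [q [Dq Hq]]; exists (fOr p q).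
  split; [constructor; auto|].
  intros e He; rewrite <- Hp, <- Hq by auto; simpl.
  split; [intros [w [H | H]]; eauto | intros [[w H] | [w H]]; eauto].
Qed.

Lemma S1_and (d : nat) P Q : S1 d P -> S1 d Q -> S1 d (fun e => P e /\ Q e).
Proof.
  intros [p [Dp Hp]] [q [Dq Hq]].
  apply (S1_equiv d (fun e => exists u,
    (exists w, w < u /\ sat M (scons w e) g p) /\
    (exists w, w < u /\ sat M (scons w e) g q))).
  - intros e He; rewrite <- Hp, <- Hq by auto; split.
    + intros [u [[x [_ Hx]] [y [_ Hy]]]]; eauto.
    + intros [[x Hx] [y Hy]]; exists (x + y + 1); split.
      * exists x; split; [apply lt_add | auto].
      * exists y; split; [apply lt_addl | auto].
  - apply S1_ex_D0; d0.
Qed.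

(** By collection, one u bounds the witnesses for all x below the term, and the universal quantifier
    passes into the Delta_0 matrix. *)
Lemma S1_ball (d : nat) t P :
  DT d t -> S1 (S d) (fun e => P (fun n => e (S n)) (e O)) ->
  S1 d (fun e => forall x, x < t e -> P e x).
Proof.
  intros Ht [p [Dp Hp]].
  apply (S1_equiv d (fun e => exists y, y = t e /\
    exists u, forall x, x < y -> exists w, w < u /\
      sat M (scons w (scons x e)) g p)).
  - intros e He; split.
    + intros [y [-> [u Hu]]] x Hx; destruct (Hu x Hx) as [w [_ Hw]].
      apply (Hp (scons x e) (over_scons d x e He)); eauto.
    + intros H; exists (t e); split; auto.
      apply (collect0 (fun w x => sat M (scons w (scons x e)) g p)); [d0 |].
      intros x Hx; apply (Hp (scons x e) (over_scons d x e He)), (H x Hx).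
  - apply S1_ex, S1_and.
    + apply S1_D0, D0_eq; [dt | apply DT_weaken, Ht].
    + apply S1_ex_D0; d0.
Qed.

Lemma S1_sat (d : nat) (p : form) t (E : nat -> X) :
  Sigma0 1 p -> (forall j, DT d (fun e => t e j)) ->
  S1 d (fun e => sat M (t e) E p).
Proof.
  intros Hp; remember 1%nat as n eqn:En in Hp; revert En d t.
  induction Hp as [n p Dp | n p Pp | n p Hp IH]; intros En d t Ht.
  - now apply S1_D0, D0_sat.
  - injection En as ->; inversion Pp; subst; now apply S1_D0, D0_sat.
  - injection En as ->; simpl; apply S1_ex; cbv beta.
    apply (IH eq_refl (S d)
             (fun e => scons (e O) (t (fun n => e (S n))))).
    apply DT_scons; [dt |]; intros j; apply (DT_weaken d (fun e => t e j)), Ht.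
Qed.

Lemma S1_form (d : nat) P :
  S1 d P -> exists p, Sigma0 1 p /\
    forall e, over d e -> (sat M e g p <-> P e).
Proof.
  intros [p [Dp Hp]]; exists (fEx p); split; [now apply sig_ex, sig_d0 | auto].
Qed.

Lemma S1_app1 (d : nat) (P : dom M -> Prop) a :
  S1 1 (fun e => P (e O)) -> DT d a -> S1 d (fun e => P (a e)).
Proof.
  intros HP Ha; destruct (S1_form _ _ HP) as [p [Sp Hp]].
  apply (S1_equiv d (fun e => sat M (scons (a e) f) g p)).
  - intros e _; rewrite Hp by apply over_1; reflexivity.
  - apply S1_sat; auto using DT_scons, DT_env.
Qed.

Lemma S1_app2 (d : nat) (P : dom M -> dom M -> Prop) a b :
  S1 2 (fun e => P (e O) (e 1%nat)) -> DT d a -> DT d b ->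
  S1 d (fun e => P (a e) (b e)).
Proof.
  intros HP Ha Hb; destruct (S1_form _ _ HP) as [p [Sp Hp]].
  apply (S1_equiv d (fun e => sat M (scons (a e) (scons (b e) f)) g p)).
  - intros e _; rewrite Hp by apply over_2; reflexivity.
  - apply S1_sat; auto using DT_scons, DT_env.
Qed.

Ltac s1 :=
  cbv beta;
  first
  [ assumption
  | match goal with
    | H : S1 2 (fun e => ?P (e O) (e 1%nat)) |- _ =>
        apply (S1_app2 _ P); [exact H | dt | dt]
    | H : S1 1 (fun e => ?P (e O)) |- _ =>
        apply (S1_app1 _ P); [exact H | dt] end
  | apply S1_sat; [assumption | env]
  | apply S1_ex; s1
  | apply S1_and; s1 | apply S1_or; s1
  | apply S1_ball; [dt | s1]
  | apply S1_D0; d0 ].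

Lemma ind1 (P : dom M -> Prop) :
  S1 1 (fun e => P (e O)) -> P 0 -> (forall x, P x -> P (x + 1)) ->
  forall x, P x.
Proof.
  intros HP; destruct (S1_form _ _ HP) as [p [Sp Hp]]; intros H0 HS x.
  apply (Hp (scons x f) (over_1 x)).
  apply IS1; [auto | |].
  - apply (Hp (scons 0 f) (over_1 _)); exact H0.
  - intros y Hy; apply (Hp (scons (y + 1) f) (over_1 _)).
    apply HS, (Hp (scons y f) (over_1 y)), Hy.
Qed.

(** The shape in which Sigma_2-induction meets the statement that a Sigma_1 set is bounded, b being
    the bound. *)
Lemma ind2 (IS2 : ISigma M 2) (P : dom M -> dom M -> Prop) :
  S1 2 (fun e => P (e O) (e 1%nat)) -> (exists b, ~ P b 0) ->
  (forall x, (exists b, ~ P b x) -> exists b, ~ P b (x + 1)) ->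
  forall x, exists b, ~ P b x.
Proof.
  intros [p [Dp Hp]] H0 HS x.
  assert (HP : forall y,
    sat M (scons y f) g (fEx (fAll (fNot p))) <-> exists b, ~ P b y).
  { intros y; simpl; split; intros [b Hb]; exists b.
    - rewrite <- (Hp (scons b (scons y f)) (over_2 b y)); firstorder.
    - intros w Hw; apply Hb, (Hp (scons b (scons y f)) (over_2 b y)); eauto. }
  apply HP, IS2.
  - apply sig_ex, sig_pi, pi_all, pi_d0; constructor; auto.
  - apply HP, H0.
  - intros y Hy; apply HP, HS, HP, Hy.
Qed.

Lemma collect1 (P : dom M -> dom M -> Prop) (a : dom M) :
  S1 2 (fun e => P (e O) (e 1%nat)) ->
  (forall x, x < a -> exists w, P w x) ->
  exists u, forall x, x < a -> exists w, w < u /\ P w x.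
Proof.
  intros [p [Dp Hp]] H.
  destruct (collect0 (fun v x => exists w, w < v /\ exists k, k < v /\
              sat M (scons k (scons w (scons x f))) g p) a) as [u Hu].
  - d0.
  - intros x Hx; destruct (H x Hx) as [w Hw].
    apply (Hp (scons w (scons x f)) (over_2 w x)) in Hw; destruct Hw as [k Hk].
    exists (w + k + 1), w; split; [apply lt_add |].
    exists k; split; [apply lt_addl | auto].
  - exists u; intros x Hx; destruct (Hu x Hx) as [v [Hv [w [Hw [k [_ Hk]]]]]].
    exists w; split; [now apply lt_trans with v |].
    apply (Hp (scons w (scons x f)) (over_2 w x)); eauto.
Qed.

Lemma least (P : dom M -> Prop) :
  D0 1 (fun e => P (e O)) -> (exists x, P x) ->
  exists x, P x /\ forall y, y < x -> ~ P y.
Proof.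
  intros DP [x Hx]; apply NNPP; intros N.
  assert (H : forall z y, y < z -> ~ P y).
  { apply (ind0 (fun z => forall y, y < z -> ~ P y)); [d0 | |].
    - intros y Hy; destruct (lt_0 _ Hy).
    - intros z IH y Hy; apply lt_S in Hy; destruct Hy as [Hy | ->]; auto.
      intros Pz; apply N; eauto. }
  apply (H (x + 1) x); auto; apply lt_succ.
Qed.

(** * Coding of sequences and binary expansions *)

Lemma div_ex b d : exists q r, r < d + 1 /\ b = q * (d + 1) + r.
Proof.
  apply (ind1 (fun b => exists q r, r < d + 1 /\ b = q * (d + 1) + r));
    [s1 | |].
  - exists 0, 0; split; [apply lt_ex; exists d |]; ring.
  - intros x [q [r [Hr ->]]]; apply lt_S in Hr; destruct Hr as [Hr | ->].
    + exists q, (r + 1); split; [| ring].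
      apply lt_ex in Hr; destruct Hr as [k ->]; apply lt_ex; exists k; ring.
    + exists (q + 1), 0; split; [apply lt_ex; exists d |]; ring.
Qed.

Lemma div_unique d q r q' r' :
  r < d -> r' < d -> q * d + r = q' * d + r' -> q = q' /\ r = r'.
Proof.
  assert (W : forall a u a' u', u < d -> a * d + u = a' * d + u' -> ~ a < a').
  { intros a u a' u' Hu E H; apply lt_ex in H; destruct H as [t ->].
    apply lt_ex in Hu; destruct Hu as [k Hk].
    apply (no_fix (a * d + u) (t * d + k + u')).
    rewrite E at 1.
    replace ((a + t + 1) * d + u') with (a * d + t * d + u' + d) by ring.
    rewrite Hk at 3; ring. }
  intros H1 H2 E.
  destruct (lt_total q q') as [H | [<- | H]].
  - now destruct (W q r q' r').
  - split; auto; apply addI with (q * d).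
    rewrite !(addC _ (q * d)); exact E.
  - now destruct (W q' r' q r).
Qed.

Lemma remainder_unique b d r r' : rem M b d r -> rem M b d r' -> r = r'.
Proof.
  intros [H [q E]] [H' [q' E']].
  apply (div_unique d q r q' r'); congruence.
Qed.

(** A substitute for (V+1) N!. In the beta function c has to exceed the coded values and to be
    divisible by all differences of indices below N. *)
Lemma common_multiple V N :
  exists c, V < c /\ forall i, i < N -> exists w, c = (i + 1) * w.
Proof.
  apply (ind1 (fun N => exists c, V < c /\
    forall i, i < N -> exists w, c = (i + 1) * w)); [s1 | |].
  - exists (V + 1); split; [apply lt_succ |]; intros i Hi; destruct (lt_0 _ Hi).
  - intros n [c [HV Hc]]; exists ((n + 1) * c); split.
    + apply lt_ex in HV; destruct HV as [d ->]; apply lt_ex.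
      exists (n * (V + d + 1) + d); ring.
    + intros i Hi; apply lt_S in Hi; destruct Hi as [Hi | ->]; [| eauto].
      destruct (Hc i Hi) as [w ->]; exists ((n + 1) * w); ring.
Qed.

(* Modulo 1 + (k+1)c one has (k+1)c = -1; if j < k and (k-j)w = c, then
   1 + (j+1)c = -(k-j)c, whose inverse is therefore (k+1)^3 c w. *)
Lemma beta_moduli_coprime N c j k :
  0 < c -> (forall i, i < N -> exists w, c = (i + 1) * w) -> j < k -> k < N ->
  exists u q, u * (1 + (j + 1) * c) = 1 + q * (1 + (k + 1) * c).
Proof.
  intros H0 Hc Hjk HkN; apply lt_ex in H0; destruct H0 as [c0 Hc0].
  apply lt_ex in Hjk; destruct Hjk as [e ->].
  destruct (Hc e) as [w Hw].
  { apply lt_trans with (j + e + 1); [apply lt_addl | auto]. }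
  set (J := j + 1); set (K := j + e + 1 + 1).
  assert (HK : K = J + (e + 1)) by (unfold J, K; ring).
  assert (HY : exists y, y + 1 = K * c).
  { exists ((J + e) * c + c0); rewrite Hc0, HK; ring. }
  destruct HY as [y HY].
  exists (K * K * K * c * w), (K * K * c * J * w + y).
  transitivity ((K * K * c * J * w) * (1 + K * c) + (K * c) * (K * c)).
  - rewrite Hw, HK; ring.
  - rewrite <- HY; ring.
Qed.

(** The Chinese remainder theorem by Sigma_1-induction on j: b solves the first j congruences, m is
    a multiple of the first j moduli, and m is invertible modulo each remaining one. T may have
    several values at i; the induction picks one, below the common bound V. *)
Lemma beta_code (T : dom M -> dom M -> Prop) (N : dom M) :
  S1 2 (fun e => T (e O) (e 1%nat)) ->
  (forall i, i < N -> exists v, T v i) ->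
  exists b c, forall i, i < N -> exists v, T v i /\ beta M b c i v.
Proof.
  intros ST HT; destruct (collect1 T N ST HT) as [V HV].
  destruct (common_multiple V N) as [c [HVc Hc]].
  assert (Hc0 : 0 < c).
  { destruct (lt_total 0 c) as [H | [<- | H]]; auto; now destruct (lt_0 _ HVc)
    || now destruct (lt_0 _ H). }
  assert (Hj : forall j, N < j \/ exists b m,
    (forall i, i < j ->
      (exists v, T v i /\ v < V /\ exists q, b = q * (1 + (i + 1) * c) + v) /\
      exists q, m = q * (1 + (i + 1) * c)) /\
    forall k, k < N -> k < j \/
      exists u q, u * m = 1 + q * (1 + (k + 1) * c)).
  { apply (ind1 (fun j => N < j \/ exists b m,
    (forall i, i < j ->
      (exists v, T v i /\ v < V /\ exists q, b = q * (1 + (i + 1) * c) + v) /\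
      exists q, m = q * (1 + (i + 1) * c)) /\
    forall k, k < N -> k < j \/
      exists u q, u * m = 1 + q * (1 + (k + 1) * c))).
    - s1.
    - right; exists 0, 1; split; [intros i Hi; destruct (lt_0 _ Hi) |].
      intros k _; right; exists 1, 0; ring.
    - intros j [Hj | [b [m [Hb Hm]]]].
      { left; apply lt_S; auto. }
      destruct (lt_or_le j N) as [HjN | HjN];
        [right | now left].
      destruct (HV j HjN) as [v [HvV Hv]].
      destruct (Hm j HjN) as [Hjj | [u [q Hu]]]; [now apply lt_irrefl in Hjj |].
      (* Modulo 1 + (j+1)c this z is v - b, written without subtraction because (j+1)c is -1 there.
         As u inverts m, adding m u z turns b into v. *)
      set (z := v + b * ((j + 1) * c)).
      exists (b + m * (u * z)), (m * (1 + (j + 1) * c)); split.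
      + intros i Hi; apply lt_S in Hi; destruct Hi as [Hi | ->].
        * destruct (Hb i Hi) as [[v' [Tv' [Vv' [q1 E1]]]] [q2 E2]].
          split; [exists v'; repeat split; auto; exists (q1 + q2 * (u * z))
                 | exists (q2 * (1 + (j + 1) * c)); rewrite E2; ring].
          rewrite E1 at 1; rewrite E2; ring.
        * split; [exists v; repeat split; auto | eauto].
          exists (b + q * z).
          replace (m * (u * z)) with ((u * m) * z) by ring.
          rewrite Hu; unfold z; ring.
      + intros k Hk; destruct (Hm k Hk) as [Hkj | [u' [q' Hu']]].
        { left; apply lt_S; auto. }
        destruct (lt_or_le j k) as [Hjk | Hjk]; [right | now left].
        destruct (beta_moduli_coprime N c j k Hc0 Hc Hjk Hk) as [u2 [q2 E2]].
        (* The inverse of the new product modulo the k-th modulus is the product of the inverses of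
           the old m and of the j-th modulus. *)
        exists (u' * u2), (q' + q2 + q' * q2 * (1 + (k + 1) * c)).
        replace (u' * u2 * (m * (1 + (j + 1) * c)))
          with ((u' * m) * (u2 * (1 + (j + 1) * c))) by ring.
        rewrite Hu', E2; ring. }
  destruct (Hj N) as [H | [b [m [H _]]]]; [now apply lt_irrefl in H |].
  exists b, c; intros i Hi; destruct (H i Hi) as [[v [Tv [Hv [q E]]]] _].
  exists v; split; [auto | split; [| eauto]].
  apply lt_trans with c; [now apply lt_trans with V |].
  apply lt_ex; exists (i * c); ring.
Qed.

(** * Powers of two *)

Lemma S1_pow2 : S1 2 (fun e => pow2 M (e O) (e 1%nat)).
Proof. unfold pow2, beta, rem; s1. Qed.

(** The codes of a doubling sequence are not unique, but two such sequences both start at 1, so they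
    agree by induction up to z. *)
Lemma pow2_agree b c b' c' z :
  beta M b c 0 1 -> beta M b' c' 0 1 ->
  (forall i, i < z -> exists v, beta M b c i v /\ beta M b c (i + 1) (v + v)) ->
  (forall i, i < z ->
    exists v, beta M b' c' i v /\ beta M b' c' (i + 1) (v + v)) ->
  exists v, beta M b c z v /\ beta M b' c' z v.
Proof.
  intros H0 H0' HS HS'.
  assert (H : forall i, z < i \/ exists v, beta M b c i v /\ beta M b' c' i v).
  { apply (ind1 (fun i => z < i \/
      exists v, beta M b c i v /\ beta M b' c' i v)).
    - unfold beta, rem; s1.
    - eauto.
    - intros i [Hi | [v [Hv Hv']]]; [left; apply lt_S; auto |].
      destruct (lt_or_le i z) as [Hz | Hz]; [right | auto].
      destruct (HS i Hz) as [w [Hw Hw2]].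
      destruct (HS' i Hz) as [w' [Hw' Hw2']].
      exists (v + v); split.
      + rewrite (remainder_unique _ _ _ _ Hv Hw); auto.
      + rewrite (remainder_unique _ _ _ _ Hv' Hw'); auto. }
  destruct (H z) as [Hz | Hz]; [now apply lt_irrefl in Hz | exact Hz].
Qed.

Lemma pow2_unique z p p' : pow2 M z p -> pow2 M z p' -> p = p'.
Proof.
  intros [b [c [H0 [HS Hp]]]] [b' [c' [H0' [HS' Hp']]]].
  destruct (pow2_agree b c b' c' z) as [v [Hv Hv']]; auto.
  transitivity v; eauto using remainder_unique.
Qed.

Lemma pow2_0 : pow2 M 0 1.
Proof.
  assert (H : beta M 1 1 0 1).
  { split; [apply lt_ex; exists 0; ring | exists 0; ring]. }
  exists 1, 1; split; [exact H | split; [| exact H]].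
  intros i Hi; destruct (lt_0 _ Hi).
Qed.

(** A beta code cannot be prolonged in place, so the old values and the additional entry p + p are
    coded afresh. *)
Lemma pow2_succ z p : pow2 M z p -> pow2 M (z + 1) (p + p).
Proof.
  intros Hp; pose proof Hp as [b [c [H0 [HS Hz]]]].
  destruct (beta_code (fun v i => (i < z + 1 /\ beta M b c i v) \/
              (i = z + 1 /\ v = p + p)) (z + 1 + 1)) as [b' [c' H]].
  - unfold beta, rem; s1.
  - assert (HI : forall i, z < i \/ exists v, beta M b c i v).
    { intros i; destruct (lt_total i z) as [Hi | [-> | Hi]]; eauto.
      destruct (HS i Hi) as [v [Hv _]]; eauto. }
    intros i Hi; apply lt_S in Hi; destruct Hi as [Hi | ->]; [| eauto].
    destruct (HI i) as [Hi' | [v Hv]]; [| eauto].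
    destruct (lt_asym _ _ Hi' Hi).
  - assert (H1 : forall i v, i < z + 1 -> beta M b c i v -> beta M b' c' i v).
    { intros i v Hi Hv; destruct (H i) as [w [[[_ Hw] | [-> _]] Hw']].
      - apply lt_S; auto.
      - now rewrite (remainder_unique _ _ _ _ Hv Hw).
      - now apply lt_irrefl in Hi. }
    assert (H2 : beta M b' c' (z + 1) (p + p)).
    { destruct (H (z + 1)) as [w [[[Hi _] | [_ ->]] Hw']]; auto.
      - apply lt_succ.
      - now apply lt_irrefl in Hi. }
    exists b', c'; split; [| split; auto].
    + apply H1; auto; apply lt_ex; exists z; ring.
    + intros i Hi; apply lt_S in Hi; destruct Hi as [Hi | ->].
      * destruct (HS i Hi) as [v [Hv Hv2]]; exists v; split; apply H1; auto.
        -- apply lt_S; auto.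
        -- apply lt_ex in Hi; destruct Hi as [d ->]; apply lt_ex.
           exists d; ring.
      * exists p; split; auto; apply H1; auto; apply lt_succ.
Qed.

Lemma pow2_ex z : exists p, pow2 M z p.
Proof.
  pose proof S1_pow2 as SP.
  apply (ind1 (fun z => exists p, pow2 M z p)); [s1 | |].
  - exists 1; apply pow2_0.
  - intros n [p Hp]; exists (p + p); now apply pow2_succ.
Qed.

Lemma pow2_pos z p : pow2 M z p -> exists k, p = k + 1.
Proof.
  pose proof S1_pow2 as SP.
  assert (H : forall z, exists k, pow2 M z (k + 1)).
  { apply (ind1 (fun z => exists k, pow2 M z (k + 1))); [s1 | |].
    - exists 0; rewrite add0l; apply pow2_0.
    - intros n [k Hk]; apply pow2_succ in Hk; exists (k + 1 + k).
      now rewrite <- addA. }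
  intros Hp; destruct (H z) as [k Hk]; eauto using pow2_unique.
Qed.

Lemma pow2_lt z w P p :
  z < w -> pow2 M z P -> pow2 M w p -> exists t, p = t * (P + P).
Proof.
  pose proof S1_pow2 as SP.
  intros H HP; apply lt_ex in H; destruct H as [d ->]; revert p.
  assert (Hd : forall d, exists t, pow2 M (z + d + 1) (t * (P + P))).
  { clear d; apply (ind1 (fun d => exists t, pow2 M (z + d + 1) (t * (P + P))));
      [s1 | |].
    - exists 1; rewrite add0r, mul1l; now apply pow2_succ.
    - intros d [t Ht]; exists (t + t).
      rewrite addA, mulDl; now apply pow2_succ. }
  intros p Hp; destruct (Hd d) as [t Ht]; exists t.
  eapply pow2_unique; eauto.
Qed.

(* The negation of bit_in is Sigma_1 as well. *)
Definition bit_out (z s : dom M) : Prop :=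
  exists p, pow2 M z p /\ exists q r, r < p /\ s = q * (p + p) + r.

Lemma S1_bit_out : S1 2 (fun e => bit_out (e O) (e 1%nat)).
Proof. pose proof S1_pow2; unfold bit_out; s1. Qed.

Lemma bit_dec z s : bit_in M z s \/ bit_out z s.
Proof.
  destruct (pow2_ex z) as [p Hp], (pow2_pos z p Hp) as [k Hk].
  destruct (div_ex s (p + k)) as [q [r [Hr E]]].
  (* [div_ex] divides by a successor, so the divisor 2p was entered as (p + k) + 1. The bit is on
     iff the remainder reaches p. *)
  replace (p + k + 1) with (p + p) in * by (rewrite Hk at 2; ring).
  destruct (lt_or_le r p) as [H | H].
  - right; exists p; eauto 6.
  - left; apply le_ex in H; destruct H as [d ->]; exists p; split; auto.
    exists q, d; split; [| rewrite E; ring].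
    apply lt_ex in Hr; destruct Hr as [e He]; apply lt_ex; exists e.
    apply (addI _ _ p); rewrite He; ring.
Qed.

Lemma bit_excl z s : bit_in M z s -> bit_out z s -> False.
Proof.
  intros [p [Hp [q [r [Hr E]]]]] [p' [Hp' [q' [r' [Hr' E']]]]].
  rewrite (pow2_unique _ _ _ Hp' Hp) in *.
  destruct (div_unique (p + p) q (p + r) q' r') as [_ H].
  - apply lt_ex in Hr; destruct Hr as [d ->]; apply lt_ex; exists d; ring.
  - apply lt_trans with p; auto; destruct (pow2_pos z p Hp) as [k Hk].
    apply lt_ex; exists k; rewrite Hk at 2; ring.
  - rewrite <- E', E; ring.
  - rewrite <- H in Hr'; apply lt_ex in Hr'; destruct Hr' as [d Hd].
    apply (no_fix p (r + d)); rewrite Hd at 1; ring.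
Qed.

Lemma bit_out_0 z : bit_out z 0.
Proof.
  destruct (pow2_ex z) as [p Hp]; destruct (pow2_pos z p Hp) as [k Hk].
  exists p; split; auto; exists 0, 0; split; [| ring].
  apply lt_ex; exists k; rewrite Hk; ring.
Qed.

(** A multiple of 2P is never separated from s by adding P: with bit z off, s lies in the lower half
    of its block of length 2P, and s + P lies in the upper half of the same block. *)
Lemma add_bit_lt z s P t :
  pow2 M z P -> bit_out z s -> s < t * (P + P) -> s + P < t * (P + P).
Proof.
  intros HP [P' [HP' [q [r [Hr ->]]]]]; rewrite (pow2_unique _ _ _ HP' HP) in *.
  intros H; destruct (lt_or_le t q) as [Hq | Hq].
  - exfalso; apply lt_ex in Hq; destruct Hq as [d ->].
    apply lt_ex in H; destruct H as [e He].
    apply (no_fix (t * (P + P)) ((d + 1) * (P + P) + r + e)).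
    rewrite He at 1; ring.
  - apply lt_S in Hq; destruct Hq as [Hq | ->].
    + apply lt_ex in Hq; destruct Hq as [d ->].
      apply lt_ex in Hr; destruct Hr as [e He].
      apply lt_ex; exists (d * (P + P) + e).
      transitivity (q * (P + P) + P + d * (P + P) + (r + e + 1));
        [rewrite <- He |]; ring.
    + exfalso; apply lt_ex in H; destruct H as [e He].
      apply (no_fix (t * (P + P)) (r + e)); rewrite He at 1; ring.
Qed.

(** Switching bit z on causes no carry. For w < z the number P is a multiple of 2p and only changes
    the quotient; for w > z the remainder r stays below p by [add_bit_lt], since p is a multiple of
    2P. *)
Lemma add_bit_out z w s P :
  pow2 M z P -> bit_out z s -> bit_out w s -> w <> z -> bit_out w (s + P).
Proof.
  intros HP Hz [p [Hp [q [r [Hr E]]]]] Hwz.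
  destruct (lt_total w z) as [H | [-> | H]]; [| tauto |].
  - destruct (pow2_lt w z p P H Hp HP) as [t ->].
    exists p; split; auto; exists (q + t), r; split; auto; rewrite E; ring.
  - destruct (pow2_lt z w P p H HP Hp) as [t Ht].
    exists p; split; auto; exists q, (r + P); split; [| rewrite E; ring].
    (* s and r differ by a multiple of 2p, hence of 2P, so they have the same digit at z. *)
    assert (Hzr : bit_out z r).
    { destruct (bit_dec z r) as [[P1 [HP1 [q1 [r1 [Hr1 E1]]]]] | Hzr]; auto.
      exfalso; apply (bit_excl z s); auto.
      exists P1; split; auto; rewrite <- (pow2_unique _ _ _ HP1 HP) in *.
      exists (q * (t + t) + q1), r1; split; auto; rewrite E, E1, Ht; ring. }
    rewrite Ht; apply (add_bit_lt z); auto; now rewrite <- Ht.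
Qed.

(** * The generic sequence *)

Definition unbounded (D : dom M -> Prop) : Prop :=
  forall b, exists n, b < n /\ D n.

(* Sets s < 2^a are compared as numbers.  The largest s for which D meets
   every W_z with z in s in an unbounded set decides all the W_z with z < a:
   adding z to s makes s larger.  Induction is on x = 2^a - s, with a bound
   that is uniform over the sets larger than s. *)
Lemma density (IS2 : ISigma M 2) (D : dom M -> Prop)
    (W : dom M -> dom M -> Prop) (a : dom M) :
  S1 1 (fun e => D (e O)) -> S1 2 (fun e => W (e O) (e 1%nat)) ->
  unbounded D ->
  exists D' s, S1 1 (fun e => D' (e O)) /\ unbounded D' /\
    (forall n, D' n -> D n) /\
    forall z, z < a -> bit_in M z s /\ (forall n, D' n -> W z n) \/
                       bit_out z s /\ (forall n, D' n -> ~ W z n).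
Proof.
  intros SD SW UD; destruct (pow2_ex a) as [N HN].
  pose proof S1_bit_out as SB.
  (* The intersection of D with the W_z for z in s. Membership in s occurs negatively, and [bit_out]
     keeps the condition Sigma_1. *)
  set (Q := fun n s => D n /\ forall z, z < a -> bit_out z s \/ W z n).
  assert (SQ : S1 2 (fun e => Q (e O) (e 1%nat))) by (unfold Q; s1).
  assert (HR : exists x b s,
    (forall s', s' < N -> s < s' -> forall n, b < n -> ~ Q n s') /\
    s < N /\ unbounded (fun n => Q n s) /\ N = x + s + 1).
  { apply NNPP; intros NR.
    (* [~ P b x] says that b bounds the intersections for all s with N - s at most x. The quantifier
       on s is inside the Sigma_1 predicate, which leaves a Sigma_2 induction formula. *)
    set (P := fun b x => exists s, s < N /\ N < x + s + 1 /\
                                   exists n, b < n /\ Q n s).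
    assert (HP : forall x, exists b, ~ P b x).
    { apply (ind2 IS2 P).
      - unfold P; s1.
      - exists 0; intros [s [Hs [Hs' _]]]; rewrite add0l in Hs'.
        exact (lt_asym _ _ Hs Hs').
      - intros x [b Hb]; apply NNPP; intros HS.
        (* Since b already bounds the intersections for all larger sets, only the one new s, with N
           = x + s + 1, can violate b + c; as c is arbitrary, its intersection is unbounded. *)
        assert (HS' : forall c, exists s n, s < N /\ N = x + s + 1 /\
                                            b + c < n /\ Q n s).
        { intros c; apply NNPP; intros Hc; apply HS; exists (b + c).
          intros [s [Hs [Hs' [n [Hn HQ]]]]].
          destruct (lt_or_le N (x + s + 1)) as [H | H].
          - apply Hb; exists s; split; [auto | split; [auto |]].
            exists n; split; auto.
            apply lt_le_trans with (b + c + 1); [apply lt_add |].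
            apply lt_ex in Hn; destruct Hn as [d ->]; apply lt_ex.
            exists d; ring.
          - apply Hc; exists s, n; split; [auto | split; [| auto]].
            apply lt_S in H; destruct H as [H | H]; auto; exfalso.
            apply (lt_asym _ _ H).
            replace (x + s + 1 + 1) with (x + 1 + s + 1) by ring; exact Hs'. }
        destruct (HS' 0) as [s [_ [Hs [Es _]]]].
        apply NR; exists x, b, s; split; [| split; [auto | split; [| auto]]].
        + intros s' Hs' Hss' n Hn HQ; apply Hb.
          exists s'; split; [auto | split; [| eauto]].
          apply lt_ex in Hss'; destruct Hss' as [d ->]; rewrite Es.
          apply lt_ex; exists d; ring.
        + intros c; destruct (HS' c) as [s' [n [_ [Es' [Hn HQ]]]]].
          exists n; split.
          * apply lt_ex in Hn; destruct Hn as [d ->]; apply lt_ex.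
            exists (b + d); ring.
          * replace s with s'; auto; apply (addI _ _ (x + 1)).
            transitivity N; [rewrite Es' | rewrite Es]; ring. }
    (* At x = N the empty set s = 0 is included, whose intersection is D itself, and D is
       unbounded. *)
    destruct (HP N) as [b Hb]; destruct (UD b) as [n [Hn HDn]].
    apply Hb; exists 0; split; [| split].
    - destruct (pow2_pos a N HN) as [k ->]; apply lt_ex; exists k; ring.
    - rewrite add0r; apply lt_succ.
    - exists n; repeat split; auto using bit_out_0. }
  destruct HR as [x [b [s [Hb [Hs [HU _]]]]]].
  (* Discarding the indices up to b makes the intersections for larger sets empty instead of merely
     bounded, hence D' disjoint from W_z for z outside s. *)
  exists (fun n => Q n s /\ b < n), s; split; [s1 | split; [| split]].
  - intros c; destruct (HU (b + c + 1)) as [n [Hn HQ]]; exists n.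
    split; [| split; [exact HQ |]]; apply lt_trans with (b + c + 1); auto.
    + apply lt_addl.
    + apply lt_add.
  - intros n [[HD _] _]; exact HD.
  - intros z Hz; destruct (bit_dec z s) as [Hzs | Hzs]; [left | right].
    + split; auto; intros n [[_ H] _].
      destruct (H z Hz) as [H' | H']; auto; now destruct (bit_excl z s).
    + split; auto; intros n [[HD H] Hn] HW.
      destruct (pow2_ex z) as [P HP].
      apply (Hb (s + P)) with n; auto.
      * destruct (pow2_lt z a P N Hz HP HN) as [t ->].
        now apply (add_bit_lt z).
      * destruct (pow2_pos z P HP) as [k ->]; apply lt_ex; exists k; ring.
      * split; auto; intros w Hw.
        destruct (classic (w = z)) as [-> | Hwz]; auto.
        destruct (H w Hw) as [H' | H']; auto; left.
        now apply (add_bit_out z).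
Qed.

Definition decides (D : dom M -> Prop) (W : dom M -> dom M -> Prop)
    (a : dom M) : Prop :=
  exists s, forall z, z < a -> bit_in M z s /\ (forall n, D n -> W z n) \/
                               bit_out z s /\ (forall n, D n -> ~ W z n).

(** Stage k unpairs k into a formula code and an index of a bound in [f], and applies [density];
    codes of formulas that are not Sigma_1 leave the set unchanged. The recursion runs over standard
    numbers, with choice. *)
Lemma generic_sequence (IS2 : ISigma M 2) :
  exists D : nat -> dom M -> Prop,
    (forall k, S1 1 (fun e => D k (e O))) /\ (forall k, unbounded (D k)) /\
    (forall k n, D (S k) n -> D k n) /\
    forall W a, S1 2 (fun e => W (e O) (e 1%nat)) ->
      exists k, decides (D k) W a.
Proof.
  destruct form_enum as [dec Hdec].
  set (C := fun D => S1 1 (fun e => D (e O)) /\ unbounded D).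
  set (W := fun i z n => sat M (scons z (scons n f)) g (dec i)).
  assert (step : forall (k : nat) (D : sig C), exists D' : sig C,
    (forall n, proj1_sig D' n -> proj1_sig D n) /\
    (Sigma0 1 (dec (fst (of_nat k))) ->
     decides (proj1_sig D') (W (fst (of_nat k))) (f (snd (of_nat k))))).
  { intros k [D [SD UD]].
    destruct (classic (Sigma0 1 (dec (fst (of_nat k))))) as [Hp | Hp].
    - destruct (density IS2 D (W (fst (of_nat k))) (f (snd (of_nat k))))
        as [D' [s [SD' [UD' [HD' Hs]]]]]; auto; [unfold W; s1 |].
      exists (exist _ D' (conj SD' UD')); split; auto.
      intros _; exists s; exact Hs.
    - exists (exist _ D (conj SD UD)); split; auto; tauto. }
  assert (C0 : C (fun n => n = n)).
  { split; [s1 |]; intros b; exists (b + 1); split; auto using lt_succ. }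
  set (next := fun k D =>
    proj1_sig (constructive_indefinite_description _ (step k D))).
  set (D := fix D k := match k with
    | O => exist C (fun n => n = n) C0
    | S k => next k (D k)
    end).
  assert (HD : forall k,
    (forall n, proj1_sig (D (S k)) n -> proj1_sig (D k) n) /\
    (Sigma0 1 (dec (fst (of_nat k))) ->
     decides (proj1_sig (D (S k))) (W (fst (of_nat k)))
       (f (snd (of_nat k))))).
  { intros k; simpl; unfold next.
    now destruct (constructive_indefinite_description _ (step k (D k))). }
  exists (fun k => proj1_sig (D k)); split; [| split; [| split]].
  - intros k; apply (proj2_sig (D k)).
  - intros k; apply (proj2_sig (D k)).
  - intros k; apply HD.
  - intros V a SV; destruct (S1_form _ _ SV) as [p [Sp Hp]].
    destruct (Hdec p) as [c Hc], (fsurj a) as [j Hj].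
    exists (S (npair c j)).
    destruct (HD (npair c j)) as [_ H].
    unfold npair in *; rewrite cancel_of_to in H; cbn [fst snd] in H.
    rewrite Hc, Hj in H.
    destruct (H Sp) as [s Hs]; exists s; intros z Hz.
    assert (E : forall n, W c z n <-> V z n).
    { intros n; unfold W; rewrite Hc.
      apply (Hp (scons z (scons n f)) (over_2 z n)). }
    setoid_rewrite <- E; apply Hs, Hz.
Qed.

(** * The generic ultrapower *)

Context (D : nat -> dom M -> Prop) (SD : forall k, S1 1 (fun e => D k (e O))).
Context (UD : forall k, unbounded (D k)).
Context (D_succ : forall k n, D (S k) n -> D k n).
Context (D_gen : forall W a, S1 2 (fun e => W (e O) (e 1%nat)) ->
  exists k, decides (D k) W a).

(** * The filter generated by the sequence *)

Definition ev (P : dom M -> Prop) : Prop := exists k, forall n, D k n -> P n.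

Lemma D_le j k n : (j <= k)%nat -> D k n -> D j n.
Proof. induction 1; auto. Qed.

Lemma D_max j k n : D (max j k) n -> D j n /\ D k n.
Proof.
  intros H; split; revert H; apply D_le;
    [apply Nat.le_max_l | apply Nat.le_max_r].
Qed.

Lemma ev_and P Q : ev P -> ev Q -> ev (fun n => P n /\ Q n).
Proof.
  intros [j Hj] [k Hk]; exists (max j k); intros n Hn.
  apply D_max in Hn; split; [apply Hj | apply Hk]; tauto.
Qed.

Lemma ev_mono (P Q : dom M -> Prop) : (forall n, P n -> Q n) -> ev P -> ev Q.
Proof. intros H [k Hk]; exists k; auto. Qed.

Lemma ev_mono2 (P Q R : dom M -> Prop) :
  (forall n, P n -> Q n -> R n) -> ev P -> ev Q -> ev R.
Proof.
  intros H HP HQ; apply ev_mono with (2 := ev_and _ _ HP HQ); intros n []; auto.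
Qed.

Lemma ev_all (P : dom M -> Prop) : (forall n, P n) -> ev P.
Proof. exists O; auto. Qed.

Lemma ev_inst P : ev P -> exists n, P n.
Proof. intros [k Hk]; destruct (UD k 0) as [n [_ Hn]]; eauto. Qed.

Lemma ev_contra P : ev P -> ev (fun n => ~ P n) -> False.
Proof.
  intros H H'; destruct (ev_inst _ (ev_and _ _ H H')) as [n [Hn Hn']]; auto.
Qed.

(** Predicates involving elements of the ultrapower are Sigma_1 only on some D_k. Genericity is
    applied to their restriction to D_k, and in the negative case the restriction is removed by
    passing to a later set. *)
Lemma ev_decides k (W : dom M -> dom M -> Prop) a :
  S1 2 (fun e => D k (e 1%nat) /\ W (e O) (e 1%nat)) ->
  exists s, forall z, z < a -> bit_in M z s /\ ev (W z) \/
                               bit_out z s /\ ev (fun n => ~ W z n).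
Proof.
  intros H; destruct (D_gen (fun z n => D k n /\ W z n) a H) as [j [s Hs]].
  exists s; intros z Hz; destruct (Hs z Hz) as [[Hb HW] | [Hb HW]].
  - left; split; auto; exists j; intros n Hn; apply HW, Hn.
  - right; split; auto; exists (max j k); intros n Hn HWn.
    apply D_max in Hn; apply (HW n); tauto.
Qed.

Lemma ev_dec k (P : dom M -> Prop) :
  S1 1 (fun e => D k (e O) /\ P (e O)) -> ev P \/ ev (fun n => ~ P n).
Proof.
  intros H; destruct (ev_decides k (fun _ => P) 1) as [s Hs].
  - apply (S1_app1 _ (fun n => D k n /\ P n)); [exact H | dt].
  - destruct (Hs 0) as [[_ H'] | [_ H']]; auto.
    apply lt_ex; exists 0; ring.
Qed.

(* h is an arbitrary total function, but only its restriction to some D_k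
   matters and has to be definable. *)
Definition good (h : dom M -> dom M) : Prop :=
  exists k, S1 2 (fun e => D k (e 1%nat) /\ e O = h (e 1%nat)).

(* The value at n is the least y found at the least stage w that bounds some
   solution together with its Delta_0 witness. *)
Lemma selection k (T : dom M -> dom M -> Prop) :
  S1 2 (fun e => D k (e 1%nat) /\ T (e O) (e 1%nat)) ->
  ev (fun n => exists y, T y n) ->
  exists h, good h /\ ev (fun n => T (h n) n).
Proof.
  intros [p [Dp Hp]] [j Hj]; pose proof (SD (max j k)) as SDm.
  set (Q := fun v y n => sat M (scons v (scons y (scons n f))) g p).
  assert (HQ : forall y n, (exists v, Q v y n) <-> D k n /\ T y n).
  { intros y n; apply (Hp (scons y (scons n f)) (over_2 y n)). }
  set (B := fun w y n => y < w /\ exists v, v < w /\ Q v y n).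
  set (G := fun y n => exists w, (B w y n /\ forall y', y' < y -> ~ B w y' n) /\
    forall w', w' < w -> forall y', y' < w' -> ~ B w' y' n).
  assert (SG : S1 2 (fun e => G (e O) (e 1%nat))) by (unfold G, B, Q; s1).
  assert (HG : forall n, D (max j k) n -> exists y, G y n).
  { intros n Hn; destruct (D_max _ _ _ Hn) as [Hnj Hnk].
    destruct (Hj n Hnj) as [y Hy].
    destruct (proj2 (HQ y n) (conj Hnk Hy)) as [v Hv].
    destruct (least (fun w => exists y, y < w /\ B w y n)) as [w [Hw Lw]].
    - unfold B, Q; d0.
    - exists (y + v + 1), y; split; [apply lt_add |].
      split; [apply lt_add |]; exists v; split; [apply lt_addl | auto].
    - destruct (least (fun y => B w y n)) as [y1 [Hy1 Ly1]].
      + unfold B, Q; d0.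
      + destruct Hw as [y1 [_ Hy1]]; eauto.
      + exists y1, w; split; [auto |]; intros w' Hw' y' Hy' HB.
        apply (Lw w'); eauto. }
  assert (UG : forall n y y', G y n -> G y' n -> y = y').
  { intros n y y' [w [[HB L] Lw]] [w' [[HB' L'] Lw']].
    assert (w = w').
    { destruct (lt_total w w') as [H | [H | H]]; auto; exfalso.
      - apply (Lw' w H y); auto; apply HB.
      - apply (Lw w' H y'); auto; apply HB'. }
    subst w'; destruct (lt_total y y') as [H | [H | H]]; auto; exfalso;
      [apply (L' y) | apply (L y')]; auto. }
  set (h := fun n => epsilon (inhabits 0) (fun y => G y n)).
  assert (Hh : forall n, D (max j k) n -> G (h n) n).
  { intros n Hn; apply epsilon_spec, HG, Hn. }
  exists h; split.
  - exists (max j k).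
    apply (S1_equiv 2 (fun e => D (max j k) (e 1%nat) /\ G (e O) (e 1%nat)));
      [| s1].
    intros e _; split; intros [Hn H]; split; auto.
    + eauto.
    + rewrite H; auto.
  - exists (max j k); intros n Hn.
    destruct (Hh n Hn) as [w [[[_ [v [_ Hv]]] _] _]].
    apply HQ; eauto.
Qed.

Lemma good_const a : good (fun _ => a).
Proof. exists O; pose proof (SD O); s1. Qed.

Lemma good_id : good (fun n => n).
Proof. exists O; pose proof (SD O); s1. Qed.

Lemma good_op (op : dom M -> dom M -> dom M) h h' :
  D0 3 (fun e => e O = op (e 1%nat) (e 2%nat)) -> good h -> good h' ->
  good (fun n => op (h n) (h' n)).
Proof.
  intros [p [Dp Hp]] [j Hj] [k Hk]; exists (max j k).
  pose proof (SD (max j k)) as SDm.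
  set (F := fun y n => D j n /\ y = h n) in Hj.
  set (F' := fun y n => D k n /\ y = h' n) in Hk.
  change (S1 2 (fun e => F (e O) (e 1%nat))) in Hj.
  change (S1 2 (fun e => F' (e O) (e 1%nat))) in Hk.
  apply (S1_equiv 2 (fun e => D (max j k) (e 1%nat) /\
    exists x y, (F x (e 1%nat) /\ F' y (e 1%nat)) /\
      sat M (scons (e O) (scons x (scons y f))) g p)); [| s1].
  intros e _; split.
  - intros [Hn [x [y [[[_ ->] [_ ->]] H]]]]; split; auto.
    apply (Hp _ (over_3 _ _ _)) in H; exact H.
  - intros [Hn H]; split; auto; apply D_max in Hn.
    exists (h (e 1%nat)), (h' (e 1%nat)); repeat split; try tauto.
    apply (Hp _ (over_3 _ _ _)); exact H.
Qed.

Lemma good_add h h' : good h -> good h' -> good (fun n => h n + h' n).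
Proof. apply good_op; d0. Qed.

Lemma good_mul h h' : good h -> good h' -> good (fun n => h n * h' n).
Proof. apply good_op; d0. Qed.

(** A quotient by choice: the predicate under [epsilon] depends only on the class of h, so
    equivalent functions receive the same representative. Equality in the ultrapower is thus Rocq
    equality, as [sat] requires for [fEq]. *)
Definition rep (h : dom M -> dom M) : dom M -> dom M :=
  epsilon (inhabits (fun _ => 0))
    (fun h' => good h' /\ ev (fun n => h n = h' n)).

Lemma rep_spec h : good h -> good (rep h) /\ ev (fun n => h n = rep h n).
Proof.
  intros H; unfold rep; apply epsilon_spec; exists h; split; auto.
  now apply ev_all.
Qed.

Lemma rep_eq h h' : ev (fun n => h n = h' n) -> rep h = rep h'.
Proof.
  intros H; unfold rep; f_equal; apply functional_extensionality; intros u.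
  apply propositional_extensionality; split; intros [Gu Hu]; split; auto;
    revert H Hu; apply ev_mono2; congruence.
Qed.

Definition kdom : Type := {h : dom M -> dom M | good h /\ rep h = h}.

Definition kval (x : kdom) : dom M -> dom M := proj1_sig x.

Definition cls (h : dom M -> dom M) (H : good h) : kdom :=
  exist _ (rep h) (conj (proj1 (rep_spec h H))
                        (eq_sym (rep_eq _ _ (proj2 (rep_spec h H))))).

Lemma kval_good x : good (kval x).
Proof. apply (proj2_sig x). Qed.

Lemma kval_cls h H : ev (fun n => kval (cls h H) n = h n).
Proof.
  destruct (rep_spec h H) as [_ E]; revert E; apply ev_mono; auto.
Qed.

Lemma kdom_ext x y : ev (fun n => kval x n = kval y n) <-> x = y.
Proof.
  split; [| intros ->; now apply ev_all].
  intros H; apply rep_eq in H; destruct x as [h [Gh Hh]], y as [h' [Gh' Hh']].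
  simpl in H; rewrite Hh, Hh' in H; subst h'.
  f_equal; apply proof_irrelevance.
Qed.

Definition ultrapower : struct X :=
  Struct X kdom (cls _ (good_const 0)) (cls _ (good_const 1))
    (fun x y => cls _ (good_add _ _ (kval_good x) (kval_good y)))
    (fun x y => cls _ (good_mul _ _ (kval_good x) (kval_good y)))
    (fun x y => ev (fun n => kval x n < kval y n))
    (fun x A => ev (fun n => mem M (kval x n) A)).

Local Notation K := ultrapower.

Lemma kval_add x y : ev (fun n => kval (add K x y) n = kval x n + kval y n).
Proof. exact (kval_cls _ (good_add _ _ (kval_good x) (kval_good y))). Qed.

Lemma kval_mul x y : ev (fun n => kval (mul K x y) n = kval x n * kval y n).
Proof. exact (kval_cls _ (good_mul _ _ (kval_good x) (kval_good y))). Qed.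

Definition at_index (e : nat -> dom K) (n : dom M) : nat -> dom M :=
  fun j => kval (e j) n.

Lemma at_index_scons x e n :
  at_index (scons x e) n = scons (kval x n) (at_index e n).
Proof. apply functional_extensionality; intros [|j]; reflexivity. Qed.

Lemma evalt_ultrapower e t :
  ev (fun n => kval (evalt K e t) n = evalt M (at_index e n) t).
Proof.
  induction t; simpl.
  - now apply ev_all.
  - exact (kval_cls _ (good_const 0)).
  - exact (kval_cls _ (good_const 1)).
  - eapply ev_mono2; [| apply kval_add
                      | exact (ev_and _ _ IHt1 IHt2)].
    cbv beta; intros n H [<- <-]; exact H.
  - eapply ev_mono2; [| apply kval_mul
                      | exact (ev_and _ _ IHt1 IHt2)].
    cbv beta; intros n H [<- <-]; exact H.
Qed.

(* Infinitely many elements of the ultrapower need not have a common D_k in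
   their domains, so only a finite segment of an environment is evaluated at an
   index: in splice m N u v the entries m, ..., m+N-1 of v are replaced by the
   first N entries of u. *)
Fixpoint splice (m N : nat) (u v : nat -> dom M) : nat -> dom M :=
  match N with
  | O => v
  | S N => splice m N u (fun j => if (j =? m + N)%nat then u N else v j)
  end.

Lemma splice_lt m N u v j : (j < m)%nat -> splice m N u v j = v j.
Proof.
  intros Hj; revert v; induction N as [|N IH]; intros v; simpl; auto.
  rewrite IH; destruct (Nat.eqb_spec j (m + N)); auto; lia.
Qed.

Lemma splice_ge m N u v j : (j < N)%nat -> splice m N u v (m + j)%nat = u j.
Proof.
  revert v; induction N as [|N IH]; intros v Hj; [lia|]; simpl.
  destruct (Nat.eq_dec j N) as [-> | Hne]; [| apply IH; lia].
  assert (H : forall k v, (k <= N)%nat -> splice m k u v (m + N)%nat =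
                                         v (m + N)%nat).
  { induction k as [|k IHk]; intros w Hk; simpl; auto.
    rewrite IHk by lia; destruct (Nat.eqb_spec (m + N) (m + k)); auto; lia. }
  rewrite H, Nat.eqb_refl; auto.
Qed.

(** Entries are replaced one at a time: the value of [e N] at the index becomes a fresh variable,
    tied to it by the Sigma_1 graph of [e N] and then quantified away. The induction needs arbitrary
    d, t and a because each entry adds a free variable. *)
Lemma S1_splice (p : form) (E : nat -> X) (e : nat -> dom K) (m N : nat) :
  Sigma0 1 p ->
  forall d (t : (nat -> dom M) -> nat -> dom M) a,
  (forall j, DT d (fun c => t c j)) -> DT d a ->
  exists k, S1 d (fun c => D k (a c) /\
    sat M (splice m N (at_index e (a c)) (t c)) E p).
Proof.
  intros Sp; induction N as [|N IH]; intros d t a Ht Ha.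
  - exists O; pose proof (SD O); apply S1_and.
    + now apply (S1_app1 d (D O)).
    + now apply S1_sat.
  - destruct (IH (S d)
      (fun c j => if (j =? m + N)%nat then c O else t (fun n => c (S n)) j)
      (fun c => a (fun n => c (S n)))) as [k Hk].
    + intros j; destruct (j =? m + N)%nat; [dt |].
      apply (DT_weaken d (fun c => t c j)), Ht.
    + now apply DT_weaken.
    + destruct (kval_good (e N)) as [k' Hk']; exists (max k k').
      pose proof (SD (max k k')) as SDm.
      set (F := fun y n => D k' n /\ y = kval (e N) n) in Hk'.
      change (S1 2 (fun c => F (c O) (c 1%nat))) in Hk'.
      apply (S1_equiv d (fun c => D (max k k') (a c) /\ exists y,
        F y (a c) /\ D k (a c) /\ sat M (splice m N (at_index e (a c))
          (fun j => if (j =? m + N)%nat then y else t c j)) E p)).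
      * intros c _; split.
        -- intros [Hn [y [[_ ->] [_ H]]]]; auto.
        -- intros [Hn H]; split; auto; apply D_max in Hn.
           exists (kval (e N) (a c)); repeat split; tauto.
      * apply S1_and; [now apply (S1_app1 d (D (max k k'))) |].
        apply S1_ex, S1_and; [| exact Hk].
        apply (S1_app2 _ F); [exact Hk' | dt | now apply (DT_weaken d a)].
Qed.

Lemma S1_index1 (p : form) (e : nat -> dom K) (E : nat -> X) :
  Sigma0 1 p ->
  exists k, S1 1 (fun c => D k (c O) /\ sat M (at_index e (c O)) E p).
Proof.
  intros Sp; destruct (sat_support M p) as [N HN].
  destruct (S1_splice p E e 0 N Sp 1 (fun _ => f) (fun c => c O)) as [k Hk].
  - apply DT_env.
  - dt.
  - exists k; revert Hk; apply S1_equiv; intros c _.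
    rewrite (HN E _ (at_index e (c O))); [tauto |].
    intros j Hj; now apply (splice_ge 0).
Qed.

Lemma S1_index2 (p : form) (e : nat -> dom K) (E : nat -> X) :
  Sigma0 1 p ->
  exists k, S1 2 (fun c => D k (c 1%nat) /\
    sat M (scons (c O) (at_index e (c 1%nat))) E p).
Proof.
  intros Sp; destruct (sat_support M p) as [N HN].
  destruct (S1_splice p E e 1 N Sp 2 (fun c _ => c O) (fun c => c 1%nat))
    as [k Hk].
  - intros j; dt.
  - dt.
  - exists k; revert Hk; apply S1_equiv; intros c _.
    rewrite (HN E _ (scons (c O) (at_index e (c 1%nat)))); [tauto |].
    intros [|j] Hj; [rewrite splice_lt by lia; reflexivity |].
    apply (splice_ge 1 N (at_index e (c 1%nat)) (fun _ => c O)); lia.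
Qed.

(** * Los's theorem and elementarity *)

Lemma ev_sat_dec (p : form) e E :
  Sigma0 1 p -> ev (fun n => sat M (at_index e n) E p) \/
                ev (fun n => ~ sat M (at_index e n) E p).
Proof.
  intros Sp; destruct (S1_index1 p e E Sp) as [k Hk].
  exact (ev_dec k (fun n => sat M (at_index e n) E p) Hk).
Qed.

(** Witnesses found separately at the indices are assembled into one element of the ultrapower. *)
Lemma ev_sat_selection (p : form) e E :
  Sigma0 1 p ->
  ev (fun n => exists y, sat M (scons y (at_index e n)) E p) ->
  exists x, ev (fun n => sat M (at_index (scons x e) n) E p).
Proof.
  intros Sp H; destruct (S1_index2 p e E Sp) as [k Hk].
  destruct (selection k (fun y n => sat M (scons y (at_index e n)) E p))
    as [h [Gh Hh]]; auto.
  exists (cls h Gh); revert Hh; apply ev_mono2 with (2 := kval_cls h Gh).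
  intros n Hn; rewrite at_index_scons, Hn; auto.
Qed.

Lemma los_Delta0 (p : form) (E : nat -> X) :
  Delta0 p ->
  forall e, sat K e E p <-> ev (fun n => sat M (at_index e n) E p).
Proof.
  intros Dp; induction Dp as [a b | a b | a m | p Dp IH | p q Dp IHp Dq IHq
    | p q Dp IHp Dq IHq | p q Dp IHp Dq IHq | t p Dp IH | t p Dp IH];
    intros e; simpl.
  - rewrite <- kdom_ext; generalize (ev_and _ _ (evalt_ultrapower e a)
      (evalt_ultrapower e b)); intros H; split; revert H; apply ev_mono2;
      intros n [-> ->]; auto.
  - generalize (ev_and _ _ (evalt_ultrapower e a)
      (evalt_ultrapower e b)); intros H; split; revert H; apply ev_mono2;
      intros n [-> ->]; auto.
  - generalize (evalt_ultrapower e a); intros H; split; revert H;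
      apply ev_mono2; intros n ->; auto.
  - rewrite IH; destruct (ev_sat_dec p e E (sig_d0 _ _ Dp)) as [H | H].
    + split; [tauto | intros H'; now destruct (ev_contra _ H)].
    + split; [auto | intros _ H'; now destruct (ev_contra _ H')].
  - rewrite IHp, IHq; split; [intros []; now apply ev_and |].
    intros H; split; revert H; apply ev_mono; tauto.
  - rewrite IHp, IHq; split.
    + intros [H | H]; revert H; apply ev_mono; tauto.
    + intros H; destruct (ev_sat_dec p e E (sig_d0 _ _ Dp)) as [H' | H']; auto.
      right; revert H H'; apply ev_mono2; tauto.
  - rewrite IHp, IHq; split.
    + intros H; destruct (ev_sat_dec p e E (sig_d0 _ _ Dp)) as [H' | H'].
      * generalize (H H'); apply ev_mono; tauto.
      * revert H'; apply ev_mono; tauto.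
    + apply ev_mono2; tauto.
  - split.
    + intros H.
      destruct (ev_sat_dec (fBAll t p) e E) as [H' | H'];
        [apply sig_d0; now constructor | exact H' | exfalso].
      (* If the bounded statement fails at all indices in some D_k, the counterexamples there form
         an element x below t in K, which contradicts the assumption about K. *)
      destruct (ev_sat_selection (fAnd (fLt (tvar 0) (tlift t)) (fNot p)) e E)
        as [x Hx].
      * apply sig_d0; repeat constructor; auto.
      * revert H'; apply ev_mono; simpl; intros n Hn; apply NNPP; intros N.
        apply Hn; intros y Hy; apply NNPP; intros Ny; apply N; exists y.
        now rewrite evalt_tlift.
      * apply (ev_contra (fun n => sat M (at_index (scons x e) n) E p)).
        -- apply IH, H; generalize (ev_and _ _ Hx (evalt_ultrapower e t)).
           apply ev_mono; intros n [[Hn _] En]; rewrite En; simpl in Hn.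
           now rewrite at_index_scons, evalt_tlift in Hn.
        -- revert Hx; apply ev_mono; intros n [_ Hn]; exact Hn.
    + intros H x Hx; apply IH.
      generalize (ev_and _ _ Hx (evalt_ultrapower e t)); revert H.
      apply ev_mono2; intros n Hn [Hlt En]; rewrite at_index_scons.
      apply Hn; now rewrite <- En.
  - split.
    + intros [x [Hx H]]; apply IH in H.
      generalize (ev_and _ _ Hx (evalt_ultrapower e t)); revert H.
      apply ev_mono2; intros n Hn [Hlt En]; rewrite at_index_scons in Hn.
      exists (kval x n); now rewrite <- En.
    + intros H.
      destruct (ev_sat_selection (fAnd (fLt (tvar 0) (tlift t)) p) e E)
        as [x Hx].
      * apply sig_d0; repeat constructor; auto.
      * revert H; apply ev_mono; simpl; intros n [y Hy]; exists y.
        now rewrite evalt_tlift.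
      * exists x; split.
        -- generalize (ev_and _ _ Hx (evalt_ultrapower e t)).
           apply ev_mono; intros n [[Hn _] En]; rewrite En; simpl in Hn.
           now rewrite at_index_scons, evalt_tlift in Hn.
        -- apply IH; revert Hx; apply ev_mono; intros n [_ Hn]; exact Hn.
Qed.

Lemma los_Sigma1 (p : form) (E : nat -> X) :
  Sigma0 1 p ->
  forall e, sat K e E p <-> ev (fun n => sat M (at_index e n) E p).
Proof.
  intros Sp; remember 1%nat as m eqn:Em in Sp; revert Em.
  induction Sp as [m p Dp | m p Pp | m p Sp IH]; intros Em e.
  - now apply los_Delta0.
  - injection Em as ->; inversion Pp; subst; now apply los_Delta0.
  - injection Em as ->; simpl; split.
    + intros [x Hx]; apply (IH eq_refl) in Hx; revert Hx; apply ev_mono.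
      intros n; rewrite at_index_scons; eauto.
    + intros H; destruct (ev_sat_selection p e E Sp H) as [x Hx].
      exists x; apply (IH eq_refl), Hx.
Qed.

(** Negation is not pushed through quantifier prefixes by [Sigma0], so the dual is built by hand;
    being equivalent to the negation in every structure, it serves for M and K alike. *)
Lemma Pi1_dual (p : form) :
  Pi0 1 p -> exists q, Sigma0 1 q /\
    forall (N : struct X) e E, sat N e E q <-> ~ sat N e E p.
Proof.
  intros Pp; remember 1%nat as m eqn:Em in Pp; revert Em.
  assert (W : forall p, Delta0 p -> exists q, Sigma0 1 q /\
    forall (N : struct X) e E, sat N e E q <-> ~ sat N e E p).
  { intros q Dq; exists (fNot q); split; [apply sig_d0; now constructor |].
    simpl; tauto. }
  induction Pp as [m p Dp | m p Sp | m p Pp IH]; intros Em; auto.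
  - injection Em as ->; inversion Sp; subst; auto.
  - destruct (IH Em) as [q [Sq Hq]]; exists (fEx q).
    rewrite Em in *; split; [now constructor |].
    intros N e E; simpl; setoid_rewrite Hq; split.
    + intros [x Hx] H; apply Hx, H.
    + intros H; apply NNPP; intros H'; apply H; intros x; apply NNPP; eauto.
Qed.

Lemma los_Pi1 (p : form) e (E : nat -> X) :
  Pi0 1 p -> (sat K e E p <-> ev (fun n => sat M (at_index e n) E p)).
Proof.
  intros Pp; destruct (Pi1_dual p Pp) as [q [Sq Hq]].
  transitivity (~ ~ sat K e E p); [split; [tauto | apply NNPP] |].
  rewrite <- Hq, (los_Sigma1 q E Sq).
  destruct (ev_sat_dec q e E Sq) as [H | H]; split; intros H'.
  - tauto.
  - intros _; apply (ev_contra _ H); revert H'; apply ev_mono.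
    intros n; rewrite Hq; tauto.
  - revert H; apply ev_mono; intros n; rewrite Hq; apply NNPP.
  - intros H2; now apply (ev_contra _ H2).
Qed.

(** Evaluating a witness in K at each index gives this direction. The converse would require
    choosing witnesses of a Pi_1 formula by a function with Sigma_1 graph. *)
Lemma los_Sigma2 (p : form) (E : nat -> X) :
  Sigma0 2 p ->
  forall e, sat K e E p -> ev (fun n => sat M (at_index e n) E p).
Proof.
  intros Sp; remember 2%nat as m eqn:Em in Sp; revert Em.
  induction Sp as [m p Dp | m p Pp | m p Sp IH]; intros Em e.
  - now apply los_Delta0.
  - injection Em as ->; now apply los_Pi1.
  - intros [x Hx]; apply (IH Em) in Hx; revert Hx; apply ev_mono.
    intros n; rewrite at_index_scons; simpl; eauto.
Qed.

(** * The canonical embedding *)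

Definition embed (a : dom M) : dom K := cls _ (good_const a).

Lemma kval_embed a : ev (fun n => kval (embed a) n = a).
Proof. exact (kval_cls _ (good_const a)). Qed.

(** By finite support, an environment of constants takes its intended values simultaneously on one
    D_k, so p may be of any complexity. *)
Lemma ev_sat_embed (p : form) (e : nat -> dom M) E :
  ev (fun n => sat M (at_index (fun j => embed (e j)) n) E p) <->
  sat M e E p.
Proof.
  destruct (sat_support M p) as [N HN].
  assert (H : ev (fun n => forall j, (j < N)%nat ->
    at_index (fun j => embed (e j)) n j = e j)).
  { clear HN; induction N as [|N IH]; [apply ev_all; intros n j Hj; lia |].
    generalize (kval_embed (e N)); revert IH; apply ev_mono2.
    intros n H1 H2 j Hj; destruct (Nat.eq_dec j N) as [-> | Hne]; auto.
    apply H1; lia. }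
  split.
  - intros H'; destruct (ev_inst _ (ev_and _ _ H H')) as [n [Hn Hs]].
    now apply (HN E _ _ Hn).
  - intros Hs; revert H; apply ev_mono; intros n Hn; now apply (HN E _ _ Hn).
Qed.

Lemma embed_Sigma2 : Sigma2_elementary M K embed.
Proof.
  intros p Sp e E; split.
  - remember 2%nat as m eqn:Em in Sp; revert Em e.
    induction Sp as [m p Dp | m p Pp | m p Sp IH]; intros Em e H.
    + apply los_Delta0, ev_sat_embed; auto.
    + injection Em as ->; apply los_Pi1, ev_sat_embed; auto.
    + destruct H as [x Hx]; exists (embed x).
      apply (IH Em) in Hx.
      replace (scons _ _) with (fun j => embed (scons x e j)); auto.
      apply functional_extensionality; intros [|j]; reflexivity.
  - intros H; apply (los_Sigma2 p E Sp) in H; now apply ev_sat_embed in H.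
Qed.

Lemma division_bounds_model : division_bounds M.
Proof.
  intros q d v b ->; split; apply lt_ex;
    [exists (q * d + v) | exists (q * (1 + d))]; ring.
Qed.

(** The arithmetic of K is accessible through Los's theorem: both inequalities are Delta_0 formulas
    that hold in M under every assignment. *)
Lemma division_bounds_ultrapower : division_bounds K.
Proof.
  assert (H : forall p (e : nat -> dom K),
    Delta0 p -> (forall c, sat M c g p) -> sat K e g p).
  { intros p e Dp Hp; apply los_Delta0; [auto | now apply ev_all]. }
  intros q d v b ->.
  set (t := tadd (tmul (tvar 0) (tadd tone (tvar 1))) (tvar 2)).
  split.
  - apply (H (fLt (tvar 0) (tadd t tone)) (scons q (scons d (fun _ => v))));
      [constructor |].
    intros c; now apply (division_bounds_model (c O) (c 1%nat) (c 2%nat)).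
  - apply (H (fLt (tvar 2) (tadd t tone)) (scons q (scons d (fun _ => v))));
      [constructor |].
    intros c; now apply (division_bounds_model (c O) (c 1%nat) (c 2%nat)).
Qed.

Lemma embed_bit_in z s : bit_in M z s <-> bit_in K (embed z) (embed s).
Proof.
  rewrite <- (sat_fbit M division_bounds_model (fun _ => z) g z s).
  rewrite <- (sat_fbit K division_bounds_ultrapower (fun _ => embed z) g
                (embed z) (embed s)).
  rewrite (embed_Sigma2 fbit Sigma2_fbit).
  replace (fun n => embed _)
    with (scons (embed z) (scons (embed s) (fun _ => embed z)));
    [reflexivity |].
  apply functional_extensionality; intros [|[|j]]; reflexivity.
Qed.

Lemma ev_embed2 (P : dom M -> dom M -> Prop) x y :
  ev (fun n => P (kval (embed x) n) (kval (embed y) n)) <-> P x y.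
Proof.
  generalize (ev_and _ _ (kval_embed x) (kval_embed y)); intros H; split.
  - intros H'; destruct (ev_inst _ (ev_and _ _ H H')) as [n [[Ex Ey] Hn]].
    now rewrite Ex, Ey in Hn.
  - intros H'; revert H; apply ev_mono; intros n [-> ->]; auto.
Qed.

Lemma embed_op (op : dom M -> dom M -> dom M) z x y :
  ev (fun n => kval z n = op (kval (embed x) n) (kval (embed y) n)) ->
  embed (op x y) = z.
Proof.
  intros Hz; apply kdom_ext.
  generalize (ev_and _ _ (kval_embed x) (kval_embed y)); intros H.
  generalize (ev_and _ _ (kval_embed (op x y)) (ev_and _ _ H Hz)).
  apply ev_mono; intros n [-> [[Ex Ey] ->]]; now rewrite Ex, Ey.
Qed.

Lemma embed_end_extension : end_extension M K embed.
Proof.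
  split; [split; [| split; [| split; [| split; [| split; [| split]]]]] |].
  - intros x y H; apply (kdom_ext (embed x) (embed y)) in H.
    now apply (ev_embed2 eq).
  - reflexivity.
  - reflexivity.
  - intros x y; apply (embed_op (add M)), kval_add.
  - intros x y; apply (embed_op (mul M)), kval_mul.
  - intros x y; symmetry; apply (ev_embed2 (lt M)).
  - intros x A; symmetry; apply (ev_embed2 (fun y _ => mem M y A) x x).
  - intros x; apply NNPP; intros Hx; apply not_or_and in Hx.
    destruct Hx as [Hx Ha]; apply not_all_ex_not in Ha; destruct Ha as [a Ha].
    destruct (ev_sat_dec (fLt (tvar 0) (tvar 1))
                (scons (embed a) (fun _ => x)) g) as [H | H];
      [apply sig_d0; constructor | now apply Ha |].
    destruct (kval_good x) as [k Sk].
    (* Here x is at most a on some D_i. One index n in a common later set suffices: its value z =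
       x(n) is at most a, and n itself lies in W_z, so D_j is contained in W_z and x is constant on
       D_j. *)
    destruct (D_gen (fun z n => D k n /\ z = kval x n) (a + 1) Sk)
      as [j [s Hs]].
    destruct (ev_and _ _ H (kval_embed a)) as [i Hi].
    destruct (UD (max i (max j k)) 0) as [n [_ Hn]].
    apply D_max in Hn; destruct Hn as [Hni Hn].
    apply D_max in Hn; destruct Hn as [Hnj Hnk].
    destruct (Hi n Hni) as [Hle Ea].
    change (~ kval (embed a) n < kval x n) in Hle; rewrite Ea in Hle.
    destruct (lt_or_le a (kval x n)) as [Hlt | Hlt]; [now apply Hle |].
    destruct (Hs (kval x n) Hlt) as [[_ HW] | [_ HW]].
    + apply Hx; exists (kval x n); apply kdom_ext.
      generalize (kval_embed (kval x n)).
      apply ev_mono2 with (P := fun m => kval x n = kval x m).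
      * congruence.
      * exists j; intros m Hm; apply (HW m Hm).
    + now apply (HW n).
Qed.

Lemma embed_proper : proper M K embed.
Proof.
  (* The identity is not constant on any D_k, because D_k is unbounded. *)
  exists (cls _ good_id); intros x Hx; apply kdom_ext in Hx.
  destruct (ev_and _ _ Hx (ev_and _ _ (kval_embed x) (kval_cls _ good_id)))
    as [k Hk].
  destruct (UD k x) as [n [Hxn Hn]]; destruct (Hk n Hn) as [E1 [E2 E3]].
  rewrite E1, E3 in E2; subst n; now apply lt_irrefl in Hxn.
Qed.

Lemma ultrapower_coding (p : form) :
  Sigma0 1 p -> forall (e : nat -> dom K) E a, exists c, forall z,
    lt K z (embed a) -> (sat K (scons z e) E p <-> bit_in K z c).
Proof.
  intros Sp e E a; destruct (S1_index2 p e E Sp) as [k Hk].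
  destruct (ev_decides k (fun z n => sat M (scons z (at_index e n)) E p) a Hk)
    as [s Hs].
  exists (embed s); intros x Hx.
  (* The decided family is indexed by elements of M; the end extension property ensures that K has
     no others below [embed a]. *)
  destruct (proj2 embed_end_extension x) as [[z <-] | Hax].
  - apply (ev_embed2 (lt M)) in Hx.
    rewrite <- embed_bit_in, (los_Sigma1 p E Sp).
    assert (Hz : ev (fun n => sat M (at_index (scons (embed z) e) n) E p) <->
                 ev (fun n => sat M (scons z (at_index e n)) E p)).
    { generalize (kval_embed z); intros H; split; revert H; apply ev_mono2;
        intros n Hn; rewrite at_index_scons, Hn; auto. }
    rewrite Hz; destruct (Hs z Hx) as [[Hb H] | [Hb H]].
    + tauto.
    + split; intros H'; exfalso; [now apply (ev_contra _ H') |].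
      now apply (bit_excl z s).
  - exfalso; destruct (ev_inst _ (ev_and _ _ Hx (Hax a))) as [n [H1 H2]].
    apply (lt_irrefl (kval x n)), (lt_trans _ _ _ H1 H2).
Qed.

End Model.

Theorem theorem4p6 :
  forall (S : Type) (M : struct S),
    countable_model M -> RCA0 M -> ISigma M 2 ->
    exists (K : struct S) (i : dom M -> dom K),
      end_extension M K i /\ proper M K i /\ Sigma2_elementary M K i /\
      forall p, Sigma0 1 p ->
      forall (e : nat -> dom K) (E : nat -> S) (a : dom M),
        exists c : dom K, forall z : dom K, lt K z (i a) ->
          (sat K (scons z e) E p <-> bit_in K z c).
Proof.
  intros X M [[f fsurj] [g gsurj]] [BA [IS1 _]] IS2.
  destruct (generic_sequence M f fsurj g gsurj BA IS1 IS2)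
    as [D [SD [UD [D_succ D_gen]]]].
  exists (ultrapower M f fsurj g gsurj BA IS1 D SD D_succ).
  eexists; split; [| split; [| split]].
  - apply embed_end_extension; auto.
  - apply embed_proper; auto.
  - apply embed_Sigma2; auto.
  - intros p Sp e E a; eapply ultrapower_coding; auto.
Qed.
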